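(* Let $T_1,\dots,T_d:Y\to Y$ be $d$ commuting Borel bijections of a standard Borel space $Y$ that generate a free $\mathbb{Z}^d$-action, and let $\mathcal{H}$ be a finite connected graph that is non-bipartite. Then there exists a Borel almost graph homomorphism from $\mathcal{G}_{T_1,\dots,T_d}$ to $\mathcal{H}$. In particular the almost Borel chromatic number of $\mathcal{G}_{T_1,\dots,T_d}$ is either $2$ or $3$. It is equal to $2$ if and only if there exists a two-set Borel partition $\{Y_0,Y_1\}$ of $Y$, modulo a null set, such that $T_i(Y_j)=Y_{1-j}$ for $i=1,\dots,d$ and $j=0,1$.
   Context: Graphs are undirected, with at most one edge between any pair of vertices, and may have self-loops. $\mathcal{G}_{T_1,\dots,T_d}$ is the Borel graph with vertex set $Y$ and edges $(y,T_j^{\pm1}(y))$, $y\in Y$, $1\le j\le d$. For a Borel graph $\mathcal{G}=(V,E)$ ($V$ a standard Borel space, $E\subset V\times V$ Borel), a Borel probability measure $\mu$ on $V$ is $\mathcal{G}$-invariant if $\mu\circ\phi^{-1}=\mu$ for every Borel bijection $\phi:V\to V$ with $(v,\phi(v))\in E$ for every $v\in V$; a set of vertices is $\mathcal{G}$-null (''null'') if it has measure zero for every $\mathcal{G}$-invariant probability measure. For $\mathcal{G}_{T_1,\dots,T_d}$, a Borel set is null if and only if it has measure zero for every Borel probability measure on $Y$ invariant under all $T_1,\dots,T_d$. A Borel almost graph homomorphism from $\mathcal{G}$ to $\mathcal{H}$ is a Borel map from the vertices of $\mathcal{G}$ to the vertices of $\mathcal{H}$ which is a graph homomorphism (adjacent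 vertices go to adjacent vertices) away from a $\mathcal{G}$-null set. The almost Borel chromatic number of $\mathcal{G}$ is the smallest $k$ for which there is a Borel function from the vertices to $\{1,\dots,k\}$ which is a proper coloring of $\mathcal{G}$ away from a $\mathcal{G}$-null set.
   Formalization: The claims on the almost Borel chromatic number (2 or 3, and equal to 2 iff the partition exists) assume that Y itself is not null, i.e. that some invariant probability measure exists; if Y is null (e.g. translation by 1 on the reals) one color suffices and both claims fail. *)

(* Defs.v *)
From HB Require Import structures.
From mathcomp Require Import all_boot all_order all_algebra.
From mathcomp Require Import all_classical all_reals all_analysis.

Set Implicit Arguments.
Unset Strict Implicit.
Unset Printing Implicit Defensive.

Import Order.TTheory GRing.Theory Num.Theory.

Local Open Scope classical_set_scope.
Local Open Scope ring_scope.

Definition polish (R : realType) (X : metricType R) : Prop :=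
  (forall F : set_system X, ProperFilter F -> cauchy F ->
     exists x : X, F --> x) /\
  exists2 D : set X, countable D & dense D.

(* Isomorphic, as a measurable space, to a Polish space with its Borel
   sigma-algebra.  A [measurableType] is pointed, so the empty space is
   excluded. *)
Definition standard_borel (R : realType) d (Y : measurableType d) : Prop :=
  exists (X : metricType R) (f : Y -> X),
    [/\ polish X, bijective f &
        forall A : set Y, measurable A <-> <<s (@open X) >> (f @` A)].

(* The graph with vertex set [V] and edges the pairs (v, w) such that [E v w]
   is represented by the relation [E]. *)

Definition borel_bijection d (V : measurableType d) (phi : V -> V) : Prop :=
  measurable_fun [set: V] phi /\ bijective phi.

Definition graph_invariant (R : realType) d (V : measurableType d)
    (E : V -> V -> Prop) (mu : probability V R) : Prop :=
  forall phi : V -> V, borel_bijection phi -> (forall v, E v (phi v)) ->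
  forall A : set V, measurable A -> mu (phi @^-1` A) = mu A.

Definition graph_null (R : realType) d (V : measurableType d)
    (E : V -> V -> Prop) (N : set V) : Prop :=
  measurable N /\
  forall mu : probability V R, graph_invariant E mu -> mu N = 0%E.

(* [G] is the sigma-algebra of Borel sets of the target vertex set [W]; for a
   finite graph it is [discrete_measurable], which consists of all subsets. *)
Definition borel_almost_hom (R : realType) d (V : measurableType d)
    (E : V -> V -> Prop) (W : Type) (G : set (set W)) (F : W -> W -> Prop)
    (f : V -> W) : Prop :=
  (forall A : set W, G A -> measurable (f @^-1` A)) /\
  exists2 N : set V, graph_null R E N &
    forall v w, ~ N v -> ~ N w -> E v w -> F (f v) (f w).

(* The k colors are the elements of ['I_k]. *)
Definition almost_borel_colorable (R : realType) d (V : measurableType d)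
    (E : V -> V -> Prop) (k : nat) : Prop :=
  exists c : V -> 'I_k,
    (forall A : set 'I_k, measurable (c @^-1` A)) /\
    exists2 N : set V, graph_null R E N &
      forall v w, ~ N v -> ~ N w -> E v w -> c v <> c w.

Definition almost_borel_chromatic_number_is (R : realType) d
    (V : measurableType d) (E : V -> V -> Prop) (k : nat) : Prop :=
  almost_borel_colorable R E k /\
  forall m : nat, almost_borel_colorable R E m -> (k <= m)%N.

(* Integer iterates; [pinv setT f] is the inverse of [f] when [f] is
   bijective. *)
Definition iterz (Y : pointedType) (f : Y -> Y) (n : int) : Y -> Y :=
  match n with
  | Posz k => iter k f
  | Negz k => iter k.+1 (pinv setT f)
  end.

(* T_1^(n_1) o ... o T_d^(n_d). *)
Definition Zd_act (Y : pointedType) (d : nat) (T : 'I_d -> Y -> Y)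
    (n : {ffun 'I_d -> int}) : Y -> Y :=
  \big[(fun g h => g \o h)/idfun]_(i < d) iterz (T i) (n i).

Definition generate_free_Zd_action (Y : pointedType) (d : nat)
    (T : 'I_d -> Y -> Y) : Prop :=
  forall (n : {ffun 'I_d -> int}) (y : Y), n != 0 -> Zd_act T n y <> y.

Definition action_graph (Y : pointedType) (d : nat) (T : 'I_d -> Y -> Y)
    (y z : Y) : Prop :=
  exists j : 'I_d, z = iterz (T j) 1 y \/ z = iterz (T j) (-1) y.

(* Finite graphs are symmetric relations on a [finType]; loops are allowed,
   and a graph with a loop is not bipartite. *)

Definition connected_graph (W : finType) (F : rel W) : Prop :=
  forall x y : W, connect F x y.

Definition bipartite (W : finType) (F : rel W) : Prop :=
  exists s : W -> bool, forall x y : W, F x y -> s x != s y.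

(* Main.v *)
Require Import Defs.
From HB Require Import structures.
From mathcomp Require Import all_boot all_order all_algebra.
From mathcomp Require Import all_classical all_reals all_analysis.
From mathcomp Require Import measurable_realfun zify lra.

(** Why the theorem is true.

    Colouring one finite piece.  A connected non-bipartite graph has a closed
    walk of odd length at every vertex.  Inserting it into a walk that
    oscillates along an edge {a0, a1} gives a walk that oscillates with one
    parity at the start and with the opposite parity from some time M on
    ([parity_walks]).  If a function h on a piece of the lattice Z^d changes by
    exactly one along every edge, composing such a walk with h is a graph
    homomorphism.  With h the distance to the boundary of the piece, rounded up
    to the right parity, this changes a checkerboard outside the piece into the
    opposite checkerboard at depth M inside it.  So colourings of disjoint
    pieces that are checkerboards near their boundaries can always be glued
    into a colouring of a larger piece that is a checkerboard near its own
    boundary ([hom_on_cells_extend]).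

    Cutting orbits into pieces.  For every k and q there is a Borel family of
    disjoint subsets of the orbits, of bounded size, such that every invariant
    probability gives mass at most 1/q to the points that do not have the
    whole box of radius k around them in one piece ([exists_cells]).  Points of
    a sparse Borel set claim boxes; the radius is chosen where a box grows
    slowly, which exists as boxes of Z^d grow polynomially
    ([slow_growth_step]), and a collar around the box is thrown away.  The
    collar is at most 1/q times as large as what is kept, and by
    transport of mass along the action ([gap_le_core]) this local count holds
    for all invariant probabilities at once.  That the bound does not depend on
    the probability is what makes a single null set sufficient in the end.

    The limit.  Take pieces of the n-th generation with error 2^-(n+1) and with
    k much larger than the pieces of the previous generation, and extend the
    colouring from each generation to the next.  A piece of generation n that
    comes close to the boundary of a piece of generation n + 1 is simply
    repainted.  The colour of a point changes at step n only if it is not deep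
    in its piece of generation n or n + 1, so by the Borel-Cantelli lemma almost
    every colour stabilises, and the limit is a homomorphism off a null set
    ([almost_hom_of_cells]).

    Borel inverses.  The orbit picture uses the inverses of the maps T_i, so
    they have to be Borel.  This is the theorem of Lusin and Souslin, obtained
    for bijections from the Lusin separation theorem: the images of a Borel set
    and of its complement are disjoint and analytic, hence separated by a Borel
    set ([borel_bijection_inv]).

    Chromatic numbers.  The triangle gives three colours.  One colour
    would force every orbit to meet the exceptional null set, and
    null sets have null saturations ([null_saturation]); on the complement of
    the saturation a 2-colouring is a partition exchanged by all T_i. *)

Set Implicit Arguments.
Unset Strict Implicit.
Unset Printing Implicit Defensive.

Import Order.TTheory GRing.Theory Num.Theory.
Local Open Scope classical_set_scope.
Local Open Scope ring_scope.
(** * Countable operations on measurable sets *)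

Section CountableOps.
Context d (Y : measurableType d).

Lemma measurable_exists (I : countType) (P : I -> set Y) :
  (forall i, measurable (P i)) -> measurable [set y | exists i, P i y].
Proof.
move=> mP; rewrite (_ : [set y | _] = \bigcup_i P i).
  by apply: countable_bigcupT_measurable => //; exact: countableP.
by apply/seteqP; split => y /= [i]; [exists i|move=> _; exists i].
Qed.

Lemma measurable_forall (I : countType) (P : I -> set Y) :
  (forall i, measurable (P i)) -> measurable [set y | forall i, P i y].
Proof.
move=> mP; rewrite (_ : [set y | _] = ~` [set y | exists i, (~` P i) y]).
  by apply/measurableC/measurable_exists => i; exact: measurableC.
apply/seteqP; split => y /= H; first by case=> i; apply; exact: H.
by move=> i; apply: contrapT => nP; apply: H; exists i.
Qed.

Lemma measurable_imply (b : bool) (A : set Y) :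
  measurable A -> measurable [set y | b -> A y].
Proof.
move=> mA; case: b.
  by rewrite (_ : mkset _ = A)//; apply/seteqP; split => y /=; [apply|].
by rewrite (_ : mkset _ = setT)//; apply/seteqP; split.
Qed.

End CountableOps.

(** * Suslin sets of a metric space *)

Section Suslin.
Context (R : realType) (X : metricType R).

Definition agree (n : nat) (s t : nat -> nat) := forall i, (i < n)%N -> s i = t i.

(** Closedness of [C] as a subset of the product of the space with the Baire
    space. *)
Definition code_closed (C : X -> (nat -> nat) -> Prop) :=
  forall x s,
    (forall n, exists x' s', [/\ ball x n.+1%:R^-1 x', agree n s' s & C x' s']) ->
    C x s.

(** [A] is the projection of the closed set [C]; a sequence [s] with [C x s] is
    a certificate for [x] belonging to [A]. *)
Definition suslin_code (C : X -> (nat -> nat) -> Prop) (A : set X) :=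
  code_closed C /\ forall x, A x <-> exists s, C x s.

Definition suslin (A : set X) := exists C, suslin_code C A.

(** The sequences [code_row s i] are the rows of [s] read as an infinite matrix:
    one certificate carries countably many. *)
Definition code_row (s : nat -> nat) (i n : nat) : nat := s (pickle (i, n)).

Lemma code_row_surj (t : nat -> nat -> nat) :
  exists s, forall i, code_row s i = t i.
Proof.
exists (fun m => if unpickle m is Some p then t p.1 p.2 else 0%N).
by move=> i; apply/funext => n; rewrite /code_row pickleK.
Qed.

Lemma ball_invSn_le (x y : X) (m n : nat) : (m <= n)%N ->
  ball x n.+1%:R^-1 y -> ball x m.+1%:R^-1 y.
Proof.
by move=> mn; apply: le_ball; rewrite lef_pV2 ?posrE ?ltr0n// ler_nat ltnS.
Qed.

Lemma suslin_closed (A : set X) : closed A -> suslin A.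
Proof.
move=> cA; exists (fun x _ => A x); split; last first.
  by move=> x; split=> [Ax|[]//]; exists (fun=> 0%N).
move=> x s H; apply: cA => B /nbhs_ballP[e /= e0 eB].
have /ltr_add_invr[n] : 0 < e by [].
rewrite add0r => /ltW ne.
have [x' [_ [xx' _ Ax']]] := H n.
by exists x'; split => //; apply: eB; exact: le_ball xx'.
Qed.

(** The certificate is the index of a radius for which the ball around the point
    stays inside the open set. *)
Lemma suslin_open (A : set X) : open A -> suslin A.
Proof.
move=> oA; exists (fun x s => ball x (s 0%N).+1%:R^-1 `<=` A); split.
  move=> x s H y xy.
  have ry : 0 < (s 0%N).+1%:R^-1 - mdist x y.
    by move: xy; rewrite ballEmdist /= subr_gt0.
  have /ltr_add_invr[n] := ry; rewrite add0r => nr.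
  have [x' [s' [xx' ss' H']]] := H n.+1.
  rewrite -(ss' 0%N)// in xy ry nr *; apply: H'.
  rewrite ballEmdist /=; move: xx'; rewrite ballEmdist /= => xx'.
  have := metric_triangle x' x y; rewrite (metric_sym x' x).
  have : n.+2%:R^-1 <= n.+1%:R^-1 :> R by rewrite lef_pV2 ?posrE// ler_nat.
  move: nr xx'; set a := n.+1%:R^-1; set b := n.+2%:R^-1.
  by set c := (s' 0%N).+1%:R^-1; move: a b c => a b c; lra.
move=> x; split=> [Ax|[s]]; last by apply; apply: ballxx.
have /nbhs_ballP[e /= e0 eA] : nbhs x A by apply: open_nbhs_nbhs.
have /ltr_add_invr[n] : 0 < e by [].
rewrite add0r => /ltW ne; exists (fun=> n); apply: subset_trans eA.
by move=> y; exact: le_ball.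
Qed.

Lemma code_closed_shift (C : nat -> X -> (nat -> nat) -> Prop) :
  (forall i, code_closed (C i)) ->
  code_closed (fun x s => C (s 0%N) x (fun n => s n.+1)).
Proof.
move=> cC x s H; apply: cC => n; have [x' [s' [xx' ss' H']]] := H n.+1.
exists x', (fun n => s' n.+1); split.
- exact: ball_invSn_le xx'.
- by move=> i ni; exact: ss'.
- by rewrite -(ss' 0%N).
Qed.

(** The first term of the certificate names the set of the family, the other
    terms certify membership in it. *)
Lemma suslin_code_bigcup (C : nat -> X -> (nat -> nat) -> Prop) (A : nat -> set X) :
  (forall i, suslin_code (C i) (A i)) ->
  suslin_code (fun x s => C (s 0%N) x (fun n => s n.+1)) (\bigcup_i A i).
Proof.
move=> CA; split; first by apply: code_closed_shift => i; exact: (CA i).1.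
move=> x; split=> [[i _ /(CA i).2[s Cs]]|[s Cs]].
  by exists (fun n => if n is m.+1 then s m else i).
by exists (s 0%N) => //; apply/(CA _).2; exists (fun n => s n.+1).
Qed.

(** Row [i] certifies membership in the [i]-th set; closedness survives because a
    finite part of a row is a finite part of the whole sequence. *)
Lemma suslin_code_bigcap (C : nat -> X -> (nat -> nat) -> Prop) (A : nat -> set X) :
  (forall i, suslin_code (C i) (A i)) ->
  suslin_code (fun x s => forall i, C i x (code_row s i)) (\bigcap_i A i).
Proof.
move=> CA; split.
  move=> x s H i; apply: (CA i).1 => n.
  (* beyond m lie all the entries that code the first n terms of row i *)
  pose m := maxn n (\max_(k < n) (pickle (i, val k)).+1).
  have [x' [s' [xx' ss' H']]] := H m.
  exists x', (code_row s' i); split => //.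
    by apply: ball_invSn_le xx'; rewrite leq_maxl.
  move=> k kn; apply: ss'; rewrite leq_max; apply/orP; right.
  by rewrite (leq_bigmax (Ordinal kn)).
move=> x; split=> [Ax|[s Cs] i _]; last first.
  by apply/(CA i).2; exists (code_row s i).
have /choice[t Ht] : forall i, exists t, C i x t.
  by move=> i; apply/(CA i).2; exact: Ax.
by have [s Hs] := code_row_surj t; exists s => i; rewrite Hs.
Qed.

Lemma suslin_bigcup (A : nat -> set X) :
  (forall i, suslin (A i)) -> suslin (\bigcup_i A i).
Proof. by move=> /choice[C CA]; eexists; exact: suslin_code_bigcup CA. Qed.

Lemma suslin_bigcap (A : nat -> set X) :
  (forall i, suslin (A i)) -> suslin (\bigcap_i A i).
Proof. by move=> /choice[C CA]; eexists; exact: suslin_code_bigcap CA. Qed.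

(** Suslin sets need not be closed under complements, so the induction is on
    the sets that are Suslin together with their complement. *)
Lemma borel_suslin (A : set X) : <<s @open X >> A -> suslin A.
Proof.
move=> bA; suff : suslin A /\ suslin (~` A) by case.
move: A bA; apply: smallest_sub; first split.
- by split; apply: suslin_closed; [exact: closed0|rewrite setC0; exact: closedT].
- by move=> A [sA sCA]; rewrite setTD setCK.
- move=> A sA; split; first by apply: suslin_bigcup => i; exact: (sA i).1.
  by rewrite setC_bigcup; apply: suslin_bigcap => i; exact: (sA i).2.
- move=> A oA; split; first exact: suslin_open.
  by apply: suslin_closed; exact: open_closedC.
Qed.

(** A certificate can be made to record, for each [k], on which side of [B k] the
    point lies; a finite part of it then decides [B k].  This replaces the
    refinement of the topology that would make all the [B k] clopen. *)
Lemma suslin_code_decide (A : set X) (B : nat -> set X) :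
  suslin A -> (forall k, suslin (B k)) -> (forall k, suslin (~` B k)) ->
  exists2 C, suslin_code C A &
    forall k, exists m, forall s s' x x',
      agree m s s' -> C x s -> C x' s' -> B k x -> B k x'.
Proof.
move=> [CA hA] /choice[CB hB] /choice[CN hN].
pose D k (i : nat) := if i == 0%N then CB k else CN k.
pose E i := if i is k.+1 then fun x s => D k (s 0%N) x (fun n => s n.+1) else CA.
(* row 0 certifies A; row k.+1 starts with 0 if it certifies B k, and with a
   nonzero term if it certifies the complement *)
exists (fun x s => forall i, E i x (code_row s i)).
  rewrite (_ : A = \bigcap_i (if i is k.+1 then setT else A)); last first.
    apply/seteqP; split => [x Ax [|i]//|x Ax].
    exact: (Ax 0%N).
  apply: suslin_code_bigcap => -[|k] //=.
  rewrite (_ : setT = \bigcup_i (if i == 0%N then B k else ~` B k)); last first.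
    apply/seteqP; split => // x _.
    by have [Bx|nBx] := pselect (B k x); [exists 0%N|exists 1%N].
  by apply: suslin_code_bigcup => i; rewrite /D; case: ifP.
move=> k; exists (pickle (k.+1, 0%N)).+1 => s s' x x' ss' /(_ k.+1) /= Cs /(_ k.+1) /= Cs'.
have e0 : code_row s k.+1 0 = code_row s' k.+1 0 by apply: ss'.
move: Cs Cs'; rewrite -e0 /D; case: ifP => _ Cs Cs' Bx.
  by apply/(hB k).2; eexists; exact: Cs'.
by have : (~` B k) x by apply/(hN k).2; eexists; exact: Cs.
Qed.

End Suslin.

(** * Lusin separation and Borel inverses *)

Section LusinSeparation.
Context (R : realType) (X : metricType R) (pX : polish X).
Context d (Z : measurableType d) (V : nat -> set Z).
Hypothesis mV : forall k, measurable (V k).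
Hypothesis sepV : forall z z', z <> z' -> exists k, V k z /\ ~ V k z'.

Definition separated (P Q : set Z) :=
  exists E, [/\ measurable E, P `<=` E & Q `<=` ~` E].

(** Contrapositively, if two sets cannot be separated then some pair of members
    of given countable covers cannot be separated either: this drives the
    recursion in the separation theorem. *)
Lemma separated_cover (I : countType) (P Q : set Z) (P' Q' : I -> set Z) :
  (forall z, P z -> exists i, P' i z) -> (forall z, Q z -> exists i, Q' i z) ->
  (forall i j, separated (P' i) (Q' j)) -> separated P Q.
Proof.
move=> PP' QQ' sepPQ; have /choice[E HE] : forall ij : I * I, exists E,
    [/\ measurable E, P' ij.1 `<=` E & Q' ij.2 `<=` ~` E].
  by move=> [i j]; exact: sepPQ.
exists [set z | exists i, forall j, E (i, j) z]; split.
- apply: measurable_exists => i; apply: measurable_forall => j.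
  by case: (HE (i, j)).
- move=> z /PP'[i Pi]; exists i => j; case: (HE (i, j)) => _ + _; exact.
- move=> z /QQ'[j Qj] [i /(_ j)]; case: (HE (i, j)) => _ _; exact.
Qed.

Variable q : nat -> X.
Hypothesis qdense : forall x (e : R), 0 < e -> exists n, ball (q n) e x.

(** A basic neighbourhood in the product with the Baire space, projected: a longer
    list [l] fixes more of the certificate and confines the point to a smaller
    ball around a point of the dense sequence. *)
Definition piece (C : X -> (nat -> nat) -> Prop) (l : seq (nat * nat)) : set X :=
  [set x | exists2 s, C x s & forall i, (i < size l)%N ->
     s i = (nth (0, 0)%N l i).1 /\ ball (q (nth (0, 0)%N l i).2) i.+1%:R^-1 x].

Lemma piece_rcons C l x : piece C l x -> exists p, piece C (rcons l p) x.
Proof.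
move=> [s Cs H]; have i0 : 0 < (size l).+1%:R^-1 :> R by rewrite invr_gt0.
have [n nx] := qdense x i0.
exists (s (size l), n), s => // i; rewrite size_rcons ltnS => il.
rewrite nth_rcons; case: ltngtP il => // [il _|-> _]; first exact: H.
by split.
Qed.

(** Completeness of the space gives a limit point and closedness of [C] keeps its
    certificate. *)
Lemma piece_limit C (w : nat -> nat * nat) (L : nat -> seq (nat * nat)) :
  code_closed C ->
  (forall n, size (L n) = n) ->
  (forall n i, (i < n)%N -> nth (0, 0)%N (L n) i = w i) ->
  (forall n, piece C (L n) !=set0) ->
  exists x, C x (fun i => (w i).1).
Proof.
move=> cC sL nL /choice[x_ Hx].
have xq i n : (i < n)%N -> ball (q (w i).2) i.+1%:R^-1 (x_ n).
  by move=> ni; have [s _ /(_ i)] := Hx n; rewrite sL nL// => /(_ ni)[].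
have [x xx] : exists x : X, (x_ n @[n --> \oo] : set_system X) --> x.
  apply: (pX.1 (x_ @ \oo)); apply: cauchy_exP => e e0.
  have /ltr_add_invr[i] : 0 < e by [].
  rewrite add0r => /ltW ie; exists (q (w i).2).
  by exists i.+1 => // n /= ni; apply: le_ball ie _ _; exact: xq.
exists x; apply: (cC) => n.
have n0 : 0 < n.+1%:R^-1 :> R by rewrite invr_gt0.
have /cvg_ball/(_ _ n0)[m _ Hm] := xx.
pose N := maxn m n.
have [s Cs Hs] := Hx N; exists (x_ N), s; split => //.
  by apply: Hm; rewrite /= leq_maxl.
move=> i ni; have iN : (i < N)%N by rewrite (leq_trans ni)// leq_maxr.
by have := Hs i; rewrite sL nL// => /(_ iN)[].
Qed.

(** If the images could not be separated, neither could those of smaller and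
    smaller pieces.  The pieces shrink to a point of [A] and a point of [A'],
    whose distinct images lie on different sides of some [V k].  Finitely many
    terms of the certificates decide [V k], so [V k] separates the images of two
    pieces of the sequence, a contradiction. *)
Lemma lusin_separation (f : X -> Z) (A A' : set X) :
  (forall k, suslin (f @^-1` V k)) -> (forall k, suslin (~` (f @^-1` V k))) ->
  suslin A -> suslin A' -> f @` A `&` f @` A' = set0 ->
  separated (f @` A) (f @` A').
Proof.
move=> sV sNV sA sA' AA'; apply: contrapT => nsep.
have [C [cC hC] dC] := suslin_code_decide sA sV sNV.
have [C' [cC' hC'] dC'] := suslin_code_decide sA' sNV (fun k =>
  eq_ind_r (@suslin _ _) (sV k) (setCK _)).
pose bad (l : seq (nat * nat) * seq (nat * nat)) :=
  ~ separated (f @` piece C l.1) (f @` piece C' l.2).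
have bad0 : bad ([::], [::]).
  move=> [E [mE hE hE']]; apply: nsep; exists E; split => //.
    move=> _ [x /hC[s Cs] <-]; apply: hE; exists x => //.
    by exists s.
  move=> _ [x /hC'[s Cs] <-]; apply: hE'; exists x => //.
  by exists s.
have step l : exists p, bad l -> bad (rcons l.1 p.1, rcons l.2 p.2).
  apply: contrapT => /forallNP H; apply: (H ((0, 0), (0, 0))%N) => bl; case: bl.
  apply: (@separated_cover _ _ _ (fun p => f @` piece C (rcons l.1 p))
      (fun p => f @` piece C' (rcons l.2 p))).
  - by move=> _ [x /piece_rcons[p xp] <-]; exists p, x.
  - by move=> _ [x /piece_rcons[p xp] <-]; exists p, x.
  - by move=> p p'; have /not_implyP[_ /contrapT] := H (p, p').
have [g Hg] := choice step.
pose L n := iter n (fun l => (rcons l.1 (g l).1, rcons l.2 (g l).2)) ([::], [::]).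
have badL n : bad (L n) by elim: n => //= n /Hg.
have sL n : size (L n).1 = n /\ size (L n).2 = n.
  by elim: n => //= n [IH1 IH2]; rewrite !size_rcons IH1 IH2.
have nL n i : (i < n)%N -> nth (0, 0)%N (L n).1 i = (g (L i)).1 /\
                           nth (0, 0)%N (L n).2 i = (g (L i)).2.
  elim: n => // n IH; rewrite ltnS /= !nth_rcons (sL n).1 (sL n).2.
  by case: ltngtP => // [/IH//|->].
have ne1 n : piece C (L n).1 !=set0.
  apply/set0P/negP => /eqP e0; apply: (badL n); rewrite e0 image_set0.
  by exists set0; split => //; rewrite setC0.
have ne2 n : piece C' (L n).2 !=set0.
  apply/set0P/negP => /eqP e0; apply: (badL n); rewrite e0 image_set0.
  by exists setT; split => //; rewrite setCT.
have [x Cx] := piece_limit cC (fun n => (sL n).1)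
  (fun n i ni => (nL n i ni).1) ne1.
have [x' Cx'] := piece_limit cC' (fun n => (sL n).2)
  (fun n i ni => (nL n i ni).2) ne2.
have fxx' : f x <> f x'.
  move=> e; have : (f @` A `&` f @` A') (f x).
    split; first by exists x => //; apply/hC; eexists; exact: Cx.
    by rewrite e; exists x' => //; apply/hC'; eexists; exact: Cx'.
  by rewrite AA'.
have [k [Vk nVk]] := sepV fxx'.
have [m Hm] := dC k; have [m' Hm'] := dC' k.
apply: (badL (maxn m m')); exists (V k); split => //.
  move=> _ [y [s Cs Hs] <-]; apply: (Hm _ s x y _ Cx Cs Vk) => i im.
  have iN : (i < maxn m m')%N by rewrite leq_max im.
  by have := Hs i; rewrite (sL _).1 (nL _ _ iN).1 => /(_ iN)[].
move=> _ [y [s Cs Hs] <-]; apply: (Hm' _ s x' y _ Cx' Cs nVk) => i im.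
have iN : (i < maxn m m')%N by rewrite leq_max im orbT.
by have := Hs i; rewrite (sL _).2 (nL _ _ iN).2 => /(_ iN)[].
Qed.

End LusinSeparation.

Lemma dense_enum (R : realType) (X : metricType R) (x0 : X) : polish X ->
  exists q : nat -> X, forall x (e : R), 0 < e -> exists n, ball (q n) e x.
Proof.
move=> [_ [D cD dD]].
have [f Hf] : exists f : nat -> X, D `<=` range f.
  move/pfcard_geP : cD => [->|[f]]; first by exists (fun=> x0).
  by exists f => x Dx; have [n _ <-] := (@surj _ _ _ _ f) x Dx; exists n.
exists f => x e e0.
have [] := dD (ball x e)^°.
- exists x; exact: nbhsx_ballx.
- exact: open_interior.
- by move=> y [/interior_subset xy /Hf[n _ ny]]; exists n; rewrite ny; apply: ball_sym.
Qed.

(** The separating sets are traces of the interiors of the balls with a center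
    in a countable dense set and a radius [1 / (n + 1)]. *)
Lemma separating_family (R : realType) d (Y : measurableType d) :
  standard_borel R Y -> exists V : nat -> set Y,
    (forall k, measurable (V k)) /\
    forall y z, y <> z -> exists k, V k y /\ ~ V k z.
Proof.
move=> [X [f [pX fb mf]]].
have [q Hq] := dense_enum (f point) pX.
pose V (k : nat * nat) := f @^-1` (ball (q k.1) k.2.+1%:R^-1)^°.
suff [mV sV] : (forall k, measurable (V k)) /\
    forall y z, y <> z -> exists k, V k y /\ ~ V k z.
  exists (fun n => if unpickle n is Some k then V k else set0); split.
    by move=> n; case: unpickle.
  by move=> y z /sV[k Hk]; exists (pickle k); rewrite pickleK.
split=> [k|y z yz].
  apply/mf; rewrite image_preimage; first by apply: sub_sigma_algebra; exact: open_interior.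
  by apply/seteqP; split => // x _; have [g _ gK] := fb; exists (g x).
have /ltr_add_invr[n] : 0 < mdist (f y) (f z) / 2.
  by rewrite divr_gt0// mdist_gt0; apply/eqP => /(bij_inj fb).
rewrite add0r; set r := n.+1%:R^-1 => rd.
have r0 : 0 < r by rewrite invr_gt0.
have [m my] := Hq (f y) (r / 2) (divr_gt0 r0 (ltr0Sn _ 1)).
exists (m, n); split.
  apply/nbhs_ballP; exists (r / 2) => /=; first by rewrite divr_gt0.
  by move=> x yx; have := ball_triangle my yx; rewrite -splitr.
move=> /interior_subset mz.
have := ball_triangle (ball_sym my) mz; rewrite ballEmdist /= => h.
by move: rd h r0; rewrite -?/r; clear; move: r (mdist _ _) => r' D; lra.
Qed.

(** Lusin-Souslin for bijections: [T @` B] and [T @` (~` B)] are complementary and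
    analytic, so a Borel set that separates them is equal to [T @` B]. *)
Lemma borel_bijection_inv (R : realType) d (Y : measurableType d) (T S : Y -> Y) :
  standard_borel R Y -> borel_bijection T -> cancel T S -> cancel S T ->
  borel_bijection S.
Proof.
move=> hY [mT bT] TK SK; split; last by exists T.
have [V [mV sV]] := separating_family hY.
have [X [f [pX [g fK gK] mf]]] := hY.
have [q Hq] := dense_enum (f point) pX.
have sus B : measurable B -> suslin (f @` B).
  by move=> /mf; exact: borel_suslin.
have mT' B : measurable B -> measurable (T @^-1` B).
  by move=> mB; rewrite -[_ @^-1` _]setTI; exact: mT.
have preE (B : set Y) : (T \o g) @^-1` B = f @` (T @^-1` B).
  apply/seteqP; split => [x /= Bx|_ [y By <-]] /=; last by rewrite fK.
  by exists (g x); rewrite ?gK.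
have imE (B : set Y) : (T \o g) @` (f @` B) = S @^-1` B.
  apply/seteqP; split => [_ [_ [y By <-] <-]|y /= By] /=; first by rewrite fK TK.
  by exists (f (S y)); [exists (S y)|rewrite /= fK SK].
move=> _ B mB; rewrite setTI.
have [|||||E [mE BE nBE]] := lusin_separation pX mV sV Hq (f := T \o g)
    (A := f @` B) (A' := f @` (~` B)).
- by move=> k; rewrite preE; apply/sus/mT'.
- by move=> k; rewrite preimage_setC preE; apply/sus/mT'/measurableC.
- exact: sus.
- by apply/sus/measurableC.
- by rewrite !imE preimage_setC setICr.
suff -> : S @^-1` B = E by [].
rewrite !imE in BE nBE; apply/seteqP; split => // y Ey.
by apply: contrapT => nB; exact: (nBE y nB Ey).
Qed.

(** * The action of the lattice *)

Section Action.
Context (R : realType) disp (Y : measurableType disp) (d : nat).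
Variable T : 'I_d -> Y -> Y.
Hypothesis hY : standard_borel R Y.
Hypothesis hT : forall i, borel_bijection (T i).
Hypothesis hcomm : forall i j y, T i (T j y) = T j (T i y).
Local Notation Gam := {ffun 'I_d -> int}.
Local Notation S i := (pinv [set: Y] (T i)).

Lemma bij_pinvK (f : Y -> Y) : bijective f -> cancel f (pinv setT f).
Proof. by move=> /bij_inj fi y; rewrite pinvKV ?inE// => ? ? _ _; exact: fi. Qed.

Lemma bij_pinvVK (f : Y -> Y) : bijective f -> cancel (pinv setT f) f.
Proof.
move=> fb; have [g _ gK] := fb.
by move=> y; rewrite -{1}(gK y) bij_pinvK.
Qed.

Let TK i : cancel (T i) (S i). Proof. exact: bij_pinvK (hT i).2. Qed.
Let SK i : cancel (S i) (T i). Proof. exact: bij_pinvVK (hT i).2. Qed.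

Lemma iterzS i (n : int) y : iterz (T i) (n + 1) y = T i (iterz (T i) n y).
Proof.
case: n => n; first by rewrite -PoszD addn1.
rewrite NegzE; case: n => [|n]; first by rewrite addNr /= SK.
by rewrite (_ : _ + 1 = Negz n) /= ?SK// NegzE; lia.
Qed.

Lemma iterzP i (n : int) y : iterz (T i) (n - 1) y = S i (iterz (T i) n y).
Proof. by rewrite -{2}(subrK 1 n) iterzS TK. Qed.

Lemma iterzD i (m n : int) y :
  iterz (T i) (m + n) y = iterz (T i) m (iterz (T i) n y).
Proof.
elim: m => [|m IH|m IH]; first by rewrite add0r.
  by rewrite -addn1 PoszD -addrA [1 + n]addrC addrA !iterzS IH.
by rewrite -addn1 PoszD opprD addrAC !iterzP IH.
Qed.

Lemma iterz_comm i j (m n : int) y :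
  iterz (T i) m (iterz (T j) n y) = iterz (T j) n (iterz (T i) m y).
Proof.
have h1 k z : T j (iterz (T i) k z) = iterz (T i) k (T j z).
  elim: k => [//|k IH|k IH].
    by rewrite -addn1 PoszD !iterzS -IH hcomm.
  rewrite -addn1 PoszD opprD !iterzP -IH.
  by apply: (can_inj (TK i)); rewrite SK hcomm SK.
elim: n => [//|n IH|n IH].
  by rewrite -addn1 PoszD !iterzS -IH h1.
rewrite -addn1 PoszD opprD !iterzP -IH.
by apply: (can_inj (TK j)); rewrite SK h1 SK.
Qed.

Let bigact (s : seq 'I_d) (n : Gam) : Y -> Y :=
  \big[(fun g h => g \o h)/idfun]_(i <- s) iterz (T i) (n i).

Lemma act0 y : Zd_act T 0 y = y.
Proof.
rewrite /Zd_act; elim: (index_enum _) => [|i s IH]; first by rewrite big_nil.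
by rewrite big_cons /= IH ffunE.
Qed.

Lemma actD (m n : Gam) y : Zd_act T (m + n) y = Zd_act T m (Zd_act T n y).
Proof.
have comm s i k z : bigact s n (iterz (T i) k z) = iterz (T i) k (bigact s n z).
  elim: s => [|j s IH] in z *; rewrite /bigact ?big_nil// !big_cons /=.
  by rewrite [X in iterz _ _ X]IH iterz_comm.
have commm s i k z : bigact s m (iterz (T i) k z) = iterz (T i) k (bigact s m z).
  elim: s => [|j s IH] in z *; rewrite /bigact ?big_nil// !big_cons /=.
  by rewrite [X in iterz _ _ X]IH iterz_comm.
rewrite /Zd_act -/(bigact _ _) -/(bigact _ m) -/(bigact _ n).
elim: (index_enum _) => [|i s IH]; first by rewrite /bigact !big_nil.
rewrite /bigact !big_cons /= -/(bigact _ _) -/(bigact _ m) -/(bigact _ n).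
by rewrite IH commm ffunE iterzD.
Qed.

Definition gen (i : 'I_d) : Gam := [ffun j => (j == i)%:Z].

Lemma act_iter_gen (i : 'I_d) (k : int) y :
  Zd_act T [ffun j => if j == i then k else 0] y = iterz (T i) k y.
Proof.
rewrite /Zd_act -/(bigact _ _).
suff : forall s, uniq s -> bigact s [ffun j => if j == i then k else 0] y =
    if i \in s then iterz (T i) k y else y.
  by move=> /(_ _ (index_enum_uniq _)); rewrite mem_index_enum.
elim => [|j s IH] /=; first by rewrite /bigact big_nil.
move=> /andP[js us]; rewrite /bigact big_cons /= -/(bigact _ _) IH// ffunE in_cons.
rewrite eq_sym; case: eqVneq => [eij|//]; rewrite -eij in js *.
by rewrite (negbTE js).
Qed.

Lemma act_gen i y : Zd_act T (gen i) y = T i y.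
Proof.
rewrite (_ : T i y = iterz (T i) 1 y)// -act_iter_gen; congr Zd_act.
by apply/ffunP => j; rewrite !ffunE; case: eqP.
Qed.

Lemma borel_bijection_T_inv i : borel_bijection (S i).
Proof. exact: borel_bijection_inv hY (hT i) (TK i) (SK i). Qed.

(** Properties of all [Zd_act T n] are proved by composing with one map or one
    inverse map at a time. *)
Lemma iterz_preim_ind (Q : (Y -> Y) -> Prop) i (n : int) :
  Q id -> (forall f, Q f -> Q (T i \o f)) -> (forall f, Q f -> Q (S i \o f)) ->
  Q (iterz (T i) n).
Proof.
move=> Q0 QT QS; elim: n => [//|n IH|n IH].
  have -> : iterz (T i) n.+1 = T i \o iterz (T i) n by [].
  exact: QT.
rewrite -addn1 PoszD opprD (_ : iterz _ _ = S i \o iterz (T i) (- n%:Z)); first exact: QS.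
by apply/funext => y; rewrite /= iterzP.
Qed.

Lemma act_ind (Q : (Y -> Y) -> Prop) (n : Gam) :
  Q id -> (forall i f, Q f -> Q (T i \o f)) -> (forall i f, Q f -> Q (S i \o f)) ->
  Q (Zd_act T n).
Proof.
move=> Q0 QT QS; rewrite /Zd_act; elim: (index_enum _) => [|i s IH].
  by rewrite big_nil.
rewrite big_cons.
by apply: (iterz_preim_ind (Q := fun h => Q (h \o _))) => // f; [exact: QT|exact: QS].
Qed.

Lemma measurable_act (n : Gam) (A : set Y) :
  measurable A -> measurable (Zd_act T n @^-1` A).
Proof.
move: A; apply: (act_ind (Q := fun f => forall A, measurable A -> measurable (f @^-1` A))) => //.
  move=> i f IH A mA; rewrite comp_preimage; apply: IH.
  by rewrite -[X in measurable X]setTI; apply: (hT i).1.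
move=> i f IH A mA; rewrite comp_preimage; apply: IH.
by rewrite -[X in measurable X]setTI; apply: (borel_bijection_T_inv i).1.
Qed.

Lemma invariant_act (mu : probability Y R) (n : Gam) (A : set Y) :
  graph_invariant (action_graph T) mu -> measurable A ->
  mu (Zd_act T n @^-1` A) = mu A.
Proof.
move=> inv; move: A.
suff : forall A, measurable A -> measurable (Zd_act T n @^-1` A) /\ mu (Zd_act T n @^-1` A) = mu A.
  by move=> H A /H[].
apply: (act_ind (Q := fun f => forall A, measurable A ->
    measurable (f @^-1` A) /\ mu (f @^-1` A) = mu A)) => //.
  move=> i f IH A mA; rewrite comp_preimage.
  have mTA : measurable (T i @^-1` A).
    by rewrite -[X in measurable X]setTI; apply: (hT i).1.
  have [? ->] := IH _ mTA; split => //.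
  by apply: inv => // v; exists i; left.
move=> i f IH A mA; rewrite comp_preimage.
have mTA : measurable (S i @^-1` A).
  by rewrite -[X in measurable X]setTI; apply: (borel_bijection_T_inv i).1.
have [? ->] := IH _ mTA; split => //.
apply: inv => //; first exact: borel_bijection_T_inv.
by move=> v; exists i; right.
Qed.

End Action.

(** * Measurable functions to discrete types *)

Section DiscreteMeasurability.
Context disp (Y : measurableType disp).

Definition dmeasurable (I : Type) (f : Y -> I) :=
  forall B : set I, measurable (f @^-1` B).

Lemma dmeasurable_singletons (I : countType) (f : Y -> I) :
  (forall i, measurable [set y | f y = i]) -> dmeasurable f.
Proof.
move=> mf B; rewrite (_ : f @^-1` B = [set y | exists i, B i /\ f y = i]).
  apply: (measurable_exists (P := fun i => [set y | B i /\ f y = i])) => i.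
  have [Bi|nBi] := pselect (B i).
    by rewrite (_ : mkset _ = [set y | f y = i])//; apply/seteqP; split => y /= => [[]|].
  by rewrite (_ : mkset _ = set0)//; apply/seteqP; split => y //= -[].
by apply/seteqP; split => y /=; [move=> By; exists (f y)|move=> [i [Bi ->]]].
Qed.

Lemma dmeasurable_comp (I J : Type) (h : I -> J) (f : Y -> I) :
  dmeasurable f -> dmeasurable (h \o f).
Proof. by move=> mf B; rewrite comp_preimage; exact: mf. Qed.

(** Gluing: the function applied at a point may depend on countably many
    measurable alternatives.  All the colourings below are measurable because
    they are assembled in this way. *)
Lemma dmeasurable_select (I : countType) (J : Type) (i : Y -> I) (f : I -> Y -> J) :
  dmeasurable i -> (forall k, dmeasurable (f k)) ->
  dmeasurable (fun y => f (i y) y).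
Proof.
move=> mi mf B; rewrite (_ : _ @^-1` _ =
    [set y | exists k, ((i @^-1` [set k]) `&` (f k @^-1` B)) y]).
  by apply: measurable_exists => k; apply: measurableI; [exact: mi|exact: mf].
by apply/seteqP; split => y /=; [exists (i y)|move=> [k [<-]]].
Qed.

Lemma dmeasurable_cst (I : Type) (c : I) : dmeasurable (fun=> c).
Proof.
move=> B; have [Bc|nBc] := pselect (B c).
  by rewrite (_ : _ @^-1` _ = setT)//; apply/seteqP; split.
by rewrite (_ : _ @^-1` _ = set0)//; apply/seteqP; split.
Qed.

Lemma dmeasurable_pair (I J : countType) (f : Y -> I) (g : Y -> J) :
  dmeasurable f -> dmeasurable g -> dmeasurable (fun y => (f y, g y)).
Proof.
move=> mf mg; apply: (dmeasurable_select (f := fun i y => (i, g y))) => // i.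
exact: dmeasurable_comp.
Qed.

Lemma dmeasurable_map (I : Type) (J : countType) (s : seq I) (f : I -> Y -> J) :
  (forall i, dmeasurable (f i)) -> dmeasurable (fun y => [seq f i y | i <- s]).
Proof.
move=> mf; elim: s => [|i s IH] /=; first exact: dmeasurable_cst.
exact: (dmeasurable_comp (fun p => p.1 :: p.2) (dmeasurable_pair (mf i) IH)).
Qed.

Lemma dmeasurable_asbool (P : set Y) : measurable P -> dmeasurable (fun y => `[< P y >]).
Proof.
move=> mP; apply: dmeasurable_singletons => -[].
  rewrite (_ : mkset _ = P)//.
  by apply/seteqP; split => y /=; [move=> /asboolP|move=> Py; apply/asboolP].
rewrite (_ : mkset _ = ~` P); first exact: measurableC.
by apply/seteqP; split => y /=; [move=> /asboolPn|move=> Py; apply/asboolPn].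
Qed.

End DiscreteMeasurability.

(** * From pointwise counting to masses *)

Section CountingMass.
Local Open Scope ereal_scope.
Context (R : realType) disp (Y : measurableType disp) (mu : {measure set Y -> \bar R}).

Lemma sum_indicE (I : Type) (s : seq I) (A : I -> set Y) y :
  \sum_(i <- s) (\1_(A i) y)%:E = (count (fun i => `[< A i y >]) s)%:R%:E :> \bar R.
Proof.
elim: s => [|i s IH]; first by rewrite big_nil.
by rewrite big_cons IH /= indicE -EFinD natrD.
Qed.

Lemma sum_measureE (I : Type) (s : seq I) (A : I -> set Y) :
  (forall i, measurable (A i)) ->
  \sum_(i <- s) mu (A i) = \int[mu]_y \sum_(i <- s) (\1_(A i) y)%:E.
Proof.
move=> mA; rewrite ge0_integral_sum//.
- by apply: eq_bigr => i _; rewrite integral_indic// setIT.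
- by move=> i; apply/measurable_EFinP; exact: measurable_indic.
Qed.

(** Integrate the inequality between the two sums of indicator functions. *)
Lemma counting_le (I J : Type) (s : seq I) (t : seq J) (A : I -> set Y)
    (B : J -> set Y) (q : nat) :
  (forall i, measurable (A i)) -> (forall j, measurable (B j)) ->
  (forall y, (q * count (fun i => `[< A i y >]) s <=
              count (fun j => `[< B j y >]) t)%N) ->
  q%:R%:E * \sum_(i <- s) mu (A i) <= \sum_(j <- t) mu (B j).
Proof.
have mS K (u : seq K) (C : K -> set Y) : (forall k, measurable (C k)) ->
    measurable_fun setT (fun y => \sum_(k <- u) (\1_(C k) y)%:E : \bar R).
  by move=> mC; apply: emeasurable_sum => k; apply/measurable_EFinP; exact: measurable_indic.
have S0 K (u : seq K) (C : K -> set Y) y : 0 <= \sum_(k <- u) (\1_(C k) y)%:E :> \bar R.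
  by apply: sume_ge0 => k _; rewrite lee_fin.
move=> mA mB AB; rewrite !sum_measureE// -ge0_integralZl_EFin//; last exact: mS.
apply: ge0_le_integral => //.
- by move=> y _; rewrite mule_ge0.
- by apply: measurable_funeM; exact: mS.
- exact: mS.
- by move=> y _; rewrite !sum_indicE -EFinM lee_fin -natrM ler_nat.
Qed.

End CountingMass.

(** * Polynomial growth *)

(** Bernoulli's inequality for [1 + 1/q], cleared of denominators. *)
Lemma bernoulli_nat (q k : nat) : (q ^ k * (q + k) <= q * q.+1 ^ k)%N.
Proof.
elim: k => [|k IH]; first by rewrite !expn0; lia.
rewrite !expnS; move: (q ^ k)%N (q.+1 ^ k)%N IH => a b; nia.
Qed.

(** With [m = 2 k (d + 1)], it suffices that the [2 k]-th power of [1 + 1/q] exceeds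
    the linear [2 m K + 1], and the square of Bernoulli's bound is quadratic in
    [k]. *)
Lemma exp_beats_poly (d K q : nat) : (0 < q)%N ->
  exists m, (q ^ m * (2 * (m * K) + 1) ^ d < q.+1 ^ m)%N.
Proof.
move=> q0; pose k := (4 * q ^ 2 * d.+1 * K + 1)%N; exists (2 * k * d.+1)%N.
set m := (2 * k * d.+1)%N.
apply: (@leq_ltn_trans (q ^ m * (2 * (m * K) + 1) ^ d.+1)).
  by rewrite leq_mul2l leq_pexp2l ?orbT//; lia.
rewrite {1 3}/m !(expnM _ _ d.+1) -expnMn ltn_exp2r//.
have := bernoulli_nat q k; rewrite -(@leq_exp2r _ _ 2)// !expnMn -!expnM ![(k * 2)%N]mulnC.
have : (q ^ 2 * (2 * (m * K) + 1) < (q + k) ^ 2)%N by rewrite /m /k; nia.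
have : (0 < q ^ (2 * k))%N by rewrite expn_gt0 q0.
have : (0 < q ^ 2)%N by rewrite expn_gt0 q0.
move: (q ^ (2 * k))%N (q.+1 ^ (2 * k))%N ((q + k) ^ 2)%N (2 * (m * K) + 1)%N (q ^ 2)%N => a b c e f.
move=> f0 a0 h1 h2.
rewrite -(@ltn_pmul2l f)//; apply: leq_trans h2.
by rewrite mulnCA ltn_pmul2l.
Qed.

(** A sequence of polynomial growth cannot gain a factor [1 + 1/q] at each of
    the first [m] steps.  That [m] depends only on the polynomial makes all the
    radii chosen later uniformly bounded. *)
Lemma slow_growth_step (d K q : nat) : (0 < q)%N -> exists m, forall v : nat -> nat,
  (0 < v 0)%N -> (v m <= (2 * (m * K) + 1) ^ d)%N ->
  exists2 j, (j < m)%N & (q * v j.+1 <= q.+1 * v j)%N.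
Proof.
move=> q0; have [m Hm] := exp_beats_poly d K q0; exists m => v v0 vm.
apply: contrapT => H; move: Hm; rewrite ltnNge => /negP; apply.
suff : (q.+1 ^ m <= q ^ m * v m)%N by move/leq_trans; apply; rewrite leq_mul2l vm orbT.
have {}H j : (j < m)%N -> (q.+1 * v j <= q * v j.+1)%N.
  by move=> jm; rewrite leqNgt; apply/negP => lt; apply: H; exists j => //; exact: ltnW.
have : (m <= m)%N by []; elim: {1 3 4 5}m => [|j IH] jm; first by rewrite !expn0 mul1n.
rewrite !expnS -mulnA.
apply: leq_trans (leq_mul (leqnn q.+1) (IH (ltnW jm))) _.
have := H _ jm; move: (q ^ j)%N => a; rewrite (mulnCA q.+1) (mulnCA q) => h.
by rewrite leq_mul2l h orbT.
Qed.

(** * Boxes and parity in the lattice *)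

Section Lattice.
Context (d : nat).
Local Notation Gam := {ffun 'I_d -> int}.

Definition supn (g : Gam) : nat := \max_i `|g i|%N.

Lemma supn_le (g : Gam) r : (supn g <= r)%N <-> forall i, (`|g i| <= r)%N.
Proof. by split=> [/bigmax_leqP h i|h]; [exact: h|apply/bigmax_leqP => i _; exact: h]. Qed.

(** [ffunE] with the coordinates typed as integers. *)
Lemma coordD (a b : Gam) i : (a + b) i = (a i : int) + (b i : int) :> int.
Proof. by rewrite ffunE. Qed.

Lemma supnD (a b : Gam) : (supn (a + b)%R <= supn a + supn b)%N.
Proof.
apply/supn_le => i; rewrite coordD.
have /supn_le/(_ i) ha := leqnn (supn a); have /supn_le/(_ i) hb := leqnn (supn b).
by apply: leq_trans (leq_add ha hb); lia.
Qed.

Lemma supnN (a : Gam) : supn (- a) = supn a.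
Proof. by apply: eq_bigr => i _; rewrite ffunE abszN. Qed.

Lemma supn0 : supn 0 = 0%N.
Proof. by apply/eqP; rewrite -leqn0; apply/supn_le => i; rewrite ffunE. Qed.

Lemma supn_gen i : (supn (gen i) <= 1)%N.
Proof. by apply/supn_le => j; rewrite ffunE; case: eqP. Qed.

Definition cube (r : nat) : seq Gam :=
  undup [seq [ffun i => (f i : nat)%:Z - r%:Z] | f : {ffun 'I_d -> 'I_(2 * r + 1)}].

Lemma cube_uniq r : uniq (cube r). Proof. exact: undup_uniq. Qed.

Lemma mem_cube r g : (g \in cube r) = (supn g <= r)%N.
Proof.
rewrite mem_undup; apply/idP/idP.
  move=> /mapP[f _ ->]; apply/supn_le => i; rewrite ffunE.
  have le_r (k : nat) : (k < 2 * r + 1)%N -> (`|(k%:Z - r%:Z)%R| <= r)%N by lia.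
  exact: le_r (ltn_ord (f i)).
move=> /supn_le H.
have shift_lt (u : int) : (`|u| <= r)%N -> (`|(u + r%:Z)%R| < 2 * r + 1)%N by lia.
have shiftK (u : int) : (`|u| <= r)%N -> u = `|(u + r%:Z)%R|%:Z - r%:Z by lia.
have h i : (`|(g i + r%:Z)%R| < 2 * r + 1)%N by apply: shift_lt; exact: H.
apply/mapP; exists [ffun i => Ordinal (h i)]; first by rewrite mem_enum.
by apply/ffunP => i; rewrite !ffunE /=; exact: shiftK (H i).
Qed.

Lemma size_cube r : (size (cube r) <= (2 * r + 1) ^ d)%N.
Proof.
rewrite (leq_trans (size_undup _))// size_map -cardE card_ffun !card_ord.
exact: leqnn.
Qed.

(** The side of [g] in the checkerboard colouring of the lattice. *)
Definition par (g : Gam) : bool := odd (\sum_i `|g i|%N).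

Lemma parD a b : par (a + b) = par a (+) par b.
Proof.
have E (g : Gam) : par g = \big[addb/false]_i odd `|g i|%N.
  by rewrite /par; elim/big_ind2 : _ => // x1 x2 y1 y2 <- <-; rewrite oddD.
rewrite !E -big_split /=; apply: eq_bigr => i _; rewrite coordD; lia.
Qed.

Lemma parN a : par (- a) = par a.
Proof. by rewrite /par; under eq_bigr do rewrite ffunE abszN. Qed.

Lemma par_gen i : par (gen i).
Proof.
rewrite /par (bigD1 i)//= big1 ?ffunE ?eqxx// => j ji.
by rewrite ffunE (negbTE ji).
Qed.

End Lattice.

(** * Carving orbits into cells *)

Lemma count_le1 (I : eqType) (p : pred I) (s : seq I) : uniq s ->
  {in s &, forall i j, p i -> p j -> i = j} -> (count p s <= 1)%N.
Proof.
move=> us H; rewrite -size_filter.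
have := filter_uniq p us; case E : [seq i <- s | p i] => [//|i [//|j t]].
have : i \in [seq i <- s | p i] by rewrite E !inE eqxx.
have : j \in [seq i <- s | p i] by rewrite E !inE eqxx orbT.
rewrite !mem_filter => /andP[pj sj] /andP[pi si].
by rewrite (H i j)//= inE eqxx.
Qed.

Section Carving.
Context disp (Y : measurableType disp) (d : nat).
Local Notation Gam := {ffun 'I_d -> int}.
Variable act : Gam -> Y -> Y.
Hypothesis act0 : forall y, act 0 y = y.
Hypothesis actD : forall a b y, act (a + b) y = act a (act b y).
Hypothesis mact : forall g (A : set Y), measurable A -> measurable (act g @^-1` A).

Lemma actNK g : cancel (act g) (act (- g)).
Proof. by move=> y; rewrite -actD addNr act0. Qed.

Lemma actKN g : cancel (act (- g)) (act g).
Proof. by move=> y; rewrite -actD subrr act0. Qed.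

Lemma dmeasurable_act (I : Type) (f : Y -> I) g :
  dmeasurable f -> dmeasurable (f \o act g).
Proof. by move=> mf B; rewrite comp_preimage; apply: mact; exact: mf. Qed.

Definition spread (n : nat) (A : set Y) :=
  forall x g, A x -> A (act g x) -> (supn g <= n)%N -> g = 0.

Definition invariant (R : realType) (mu : probability Y R) :=
  forall g A, measurable A -> mu (act g @^-1` A) = mu A.

(** The cells have to contain most boxes of radius [k], up to an error [1/q].  The
    collar thrown away around a cell has width [w], twice [k], so that cells
    enlarged by [k] remain disjoint.  Radii are multiples [j * w] with
    [j < m]; so [Rm] bounds a radius together with its collar. *)
Variables (k q m : nat).
Let w := (2 * k)%N.
Let Rm := (m * w)%N.
Hypothesis q0 : (0 < q)%N.
Hypothesis Hm : forall v : nat -> nat,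
  (0 < v 0)%N -> (v m <= (2 * (m * w) + 1) ^ d)%N ->
  exists2 j, (j < m)%N & (q * v j.+1 <= q.+1 * v j)%N.

Definition fresh (P : set Y) (x : Y) (r : nat) :=
  count (fun g => (supn g <= r)%N && `[< ~ P (act g x) >]) (cube d Rm).

(** The collar of the box of radius [j * w] adds at most a fraction [1/q] of fresh
    points; [rad] is the first radius with this property. *)
Definition slow (P : set Y) x j := (q * fresh P x (j.+1 * w) <= q.+1 * fresh P x (j * w))%N.

Definition rad (P : set Y) x := (find (slow P x) (iota 0 m) * w)%N.

(** The fresh part has at least one point, the center, and at most as many as
    the whole box; so polynomial growth provides a slow radius. *)
Lemma radP P x : ~ P x -> (rad P x + w <= Rm)%N /\
  (q * fresh P x (rad P x + w) <= q.+1 * fresh P x (rad P x))%N.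
Proof.
move=> nPx; have [||j jm Hj] := Hm (v := fun j => fresh P x (j * w)).
- rewrite mul0n /fresh -has_count; apply/hasP; exists 0.
    by rewrite mem_cube supn0.
  by rewrite supn0 /=; apply/asboolP; rewrite act0.
- by rewrite (leq_trans (count_size _ _))// size_cube.
have hs : has (slow P x) (iota 0 m) by apply/hasP; exists j => //; rewrite mem_iota.
have fm : (find (slow P x) (iota 0 m) < m)%N by move: hs; rewrite has_find size_iota.
have := nth_find 0%N hs; rewrite nth_iota// add0n /slow mulSn addnC => h.
by split => //; rewrite /rad /Rm addnC -mulSn leq_mul2r fm orbT.
Qed.

(** One round of the carving.  Every [z] in [A] outside [P] claims the fresh points
    at distance at most [rad P z] (the core) and removes all points at distance
    at most [rad P z + w]; the points removed without being claimed form the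
    gap.  In [coreat P A g y], the point [y] is claimed by [act g y]. *)
Definition coreat (P A : set Y) g y :=
  [/\ ~ P y, A (act g y), ~ P (act g y) & (supn g <= rad P (act g y))%N].

Definition core (P A : set Y) := [set y | exists g, coreat P A g y].

Definition grow (P A : set Y) := [set y | P y \/ exists g,
  [/\ A (act g y), ~ P (act g y) & (supn g <= rad P (act g y) + w)%N]].

Definition gap (P A : set Y) := grow P A `\` P `\` core P A.

Section OneStage.
Variables (P A : set Y).
Hypothesis mP : measurable P.
Hypothesis mA : measurable A.

Lemma dmeasurable_rad : dmeasurable (rad P).
Proof.
have mfresh r : dmeasurable (fun x => fresh P x r).
  rewrite (_ : (fun x => _) =
    (fun l => count id l) \o
    (fun x => [seq (supn g <= r)%N && `[< ~ P (act g x) >] | g <- cube d Rm])).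
    apply: dmeasurable_comp; apply: dmeasurable_map => g.
    apply: (dmeasurable_comp (fun b => (supn g <= r)%N && b)).
    apply: (dmeasurable_act (f := fun y => `[< ~ P y >])).
    exact/dmeasurable_asbool/measurableC.
  by apply/funext => x /=; rewrite count_map.
rewrite (_ : rad P = (fun l => find id l * w)%N \o (fun x => [seq slow P x j | j <- iota 0 m])).
  apply/dmeasurable_comp/dmeasurable_map => j.
  exact: (dmeasurable_comp (fun p => q * p.1 <= q.+1 * p.2)%N
    (dmeasurable_pair (mfresh _) (mfresh _))).
by apply/funext => x /=; rewrite find_map.
Qed.

Let near_set (Q : nat -> bool) g : measurable [set x |
  [/\ A x, ~ P x, ~ P (act g x) & Q (rad P x)]].
Proof.
rewrite (_ : mkset _ = A `&` ~` P `&` act g @^-1` (~` P) `&` rad P @^-1` [set r | Q r]).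
  apply: measurableI; last exact: dmeasurable_rad.
  apply: measurableI; last exact/mact/measurableC.
  by apply: measurableI => //; exact: measurableC.
by apply/seteqP; split => x /= [] => [? ? ? ?|[[]]].
Qed.

Lemma measurable_coreat g : measurable (coreat P A g).
Proof.
rewrite (_ : coreat P A g = act g @^-1` [set x |
  [/\ A x, ~ P x, ~ P (act (- g) x) & (supn g <= rad P x)%N]]).
  by apply: mact; exact: (near_set (fun r => supn g <= r)%N).
by apply/seteqP; split => y /=; rewrite actNK => -[].
Qed.

Lemma measurable_core : measurable (core P A).
Proof. by apply: measurable_exists => g; exact: measurable_coreat. Qed.

Lemma measurable_grow : measurable (grow P A).
Proof.
rewrite (_ : grow P A = P `|` [set y | exists g, (P `|` act g @^-1` [set x |
  [/\ A x, ~ P x, ~ P (act (- g) x) & (supn g <= rad P x + w)%N]]) y]).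
  apply: measurableU => //; apply: measurable_exists => g; apply: measurableU => //.
  by apply: mact; exact: (near_set (fun r => supn g <= r + w)%N).
apply/seteqP; split => y /= [Py|[g]]; try by left.
  move=> [? ? ?]; have [Py|nPy] := pselect (P y); first by left.
  by right; exists g; right; rewrite actNK.
by case=> [Py|[? ? _ ?]]; [left|right; exists g].
Qed.

Lemma measurable_gap : measurable (gap P A).
Proof.
apply: measurableD; last exact: measurable_core.
by apply: measurableD => //; exact: measurable_grow.
Qed.

(** The radius was chosen so that each center removes at most [1/q] times as many
    points as it claims.  Moving the mass of every point to its center turns
    this into an inequality of measures: [G g] and [C g] are the centers [x] for
    which [act g x] is fresh and in the collar of [x], respectively claimed by
    [x], and the action preserves [mu].  The centers are so sparse that no point
    of the core is claimed twice. *)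
Lemma gap_le_core (R : realType) (mu : probability Y R) :
  spread (2 * Rm) A -> invariant mu ->
  (q%:R%:E * mu (gap P A) <= mu (core P A))%E.
Proof.
move=> sA inv.
pose G g := [set x | [/\ A x, ~ P x, ~ P (act g x) &
  (rad P x < supn g <= rad P x + w)%N]].
pose C g := [set x | [/\ A x, ~ P x, ~ P (act g x) & (supn g <= rad P x)%N]].
have mG g : measurable (G g) by exact: (near_set (fun r => r < supn g <= r + w)%N).
have mC g : measurable (C g) by exact: (near_set (fun r => supn g <= r)%N).
have GC : (q%:R%:E * \sum_(g <- cube d Rm) mu (G g) <= \sum_(g <- cube d Rm) mu (C g))%E.
  apply: counting_le => // x.
  have [Ax|nAx] := pselect (A x); last first.
    by rewrite (@eq_count _ _ pred0) ?count_pred0 ?muln0// => g; apply/asboolP => -[].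
  have [Px|nPx] := pselect (P x).
    by rewrite (@eq_count _ _ pred0) ?count_pred0 ?muln0// => g; apply/asboolP => -[].
  have [_ h] := radP nPx.
  (* gap plus core is the fresh part of the larger box *)
  rewrite -(leq_add2r (q * fresh P x (rad P x))) -mulnDr; apply: leq_trans (leq_trans h _).
    rewrite leq_mul2l; apply/orP; right; rewrite /fresh -count_predUI.
    rewrite [X in (_ + X)%N](_ : _ = 0%N) ?addn0; last first.
      apply/eqP; rewrite -leqn0 leqNgt -has_count; apply/hasPn => g _ /=.
      by apply/negP => /andP[/asboolP[_ _ _ /andP[h1 _]] /andP[h2 _]]; lia.
    apply: sub_count => g /= /orP[/asboolP[_ _ h2 /andP[_ h1]]|/andP[h1 ->]].
      by rewrite h1; exact/asboolP.
    by rewrite andbT (leq_trans h1)// leq_addr.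
  rewrite mulSn leq_add2r; apply: sub_count => g /= /andP[h1 /asboolP h2].
  exact/asboolP.
have gapG : (mu (gap P A) <= \sum_(g <- cube d Rm) mu (G g))%E.
  rewrite (eq_bigr (fun g => mu (act (- g) @^-1` G g))); last by move=> g _; rewrite inv.
  have E1 : (\sum_(u <- [:: tt]) mu (gap P A) = mu (gap P A))%E by rewrite big_seq1.
  rewrite -E1 -[X in (X <= _)%E]mul1e.
  apply: (@counting_le _ _ _ _ _ _ _ _ (fun=> gap P A) _ 1) => [_|g|y].
  - exact: measurable_gap.
  - exact: mact.
  rewrite /= addn0 mul1n.
  case: asboolP => // -[[[//|[g [Ag nPg hg]]] nPy] ncore]; rewrite -has_count.
  have gR : (supn g <= Rm)%N by rewrite (leq_trans hg)//; exact: (radP nPg).1.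
  apply/hasP; exists (- g); first by rewrite mem_cube supnN.
  apply/asboolP; rewrite /G /= opprK actNK supnN; split => //; rewrite hg andbT ltnNge.
  by apply/negP => h; apply: ncore; exists g.
have coreC : (\sum_(g <- cube d Rm) mu (C g) <= mu (core P A))%E.
  rewrite (eq_bigr (fun g => mu (act (- g) @^-1` C g))); last by move=> g _; rewrite inv.
  have E1 : (\sum_(u <- [:: tt]) mu (core P A) = mu (core P A))%E by rewrite big_seq1.
  rewrite -E1 -[X in (X <= _)%E]mul1e.
  apply: (@counting_le _ _ _ _ _ _ _ _ _ (fun=> core P A) 1) => [g|_|y].
  - exact: mact.
  - exact: measurable_core.
  rewrite mul1n /= addn0.
  case: asboolP => [_|ncore].
    apply: count_le1; first exact: cube_uniq.
    move=> g h; rewrite !mem_cube => gR hR /asboolP[Ag _ _ _] /asboolP[Ah _ _ _].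
    apply/eqP; rewrite -subr_eq0; apply/eqP/(sA _ _ Ag).
      by rewrite -actD addrAC subrr sub0r.
    by rewrite (leq_trans (supnD _ _))// supnN mul2n -addnn leq_add.
  rewrite leqn0; apply/eqP/eqP; rewrite -leqn0 leqNgt -has_count; apply/hasPn => g _.
  apply/asboolP => -[Ag nPg nPy hg]; apply: ncore; exists (- g); split => //.
    by move: nPy; rewrite actKN.
  by rewrite supnN.
apply: le_trans coreC; apply: le_trans GC.
by apply: lee_pmul.
Qed.

End OneStage.

(** For a free action, a point differs from its finitely many translates by
    nonzero elements of the box, so some finite Boolean combination [U] of the
    separating sets contains the point and none of these translates.  There are
    only countably many such [U]. *)
Lemma spread_cover (V : nat -> set Y) (n : nat) :
  (forall i, measurable (V i)) ->
  (forall y z, y <> z -> exists i, V i y /\ ~ V i z) ->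
  (forall g y, g != 0 -> act g y <> y) ->
  exists A : nat -> set Y, [/\ forall i, measurable (A i),
    forall i, spread n (A i) & forall y, exists i, A i y].
Proof.
move=> mV sV free.
pose half (p : nat * bool) := if p.2 then V p.1 else ~` V p.1.
have mhalf p : measurable (half p).
  by rewrite /half; case: ifP => _ //; exact: measurableC.
pose U (l : seq (nat * bool)) := [set y | forall p, p \in l -> half p y].
have mU l : measurable (U l).
  by apply: measurable_forall => p; exact: measurable_imply.
pose A l := [set y | U l y /\ forall g, g \in cube d n -> g != 0 -> ~ U l (act g y)].
have mA l : measurable (A l).
  rewrite (_ : A l = U l `&` [set y | forall g, g \in cube d n -> g != 0 -> ~ U l (act g y)]).
    apply: measurableI => //; apply: measurable_forall => g.
    by do 2!apply: measurable_imply; exact: (mact g (measurableC (mU l))).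
  by apply/seteqP; split => y /= [].
exists (fun i => if unpickle i is Some l then A l else set0); split.
- by move=> i; case: unpickle.
- move=> i; case: unpickle => [l|] x g //= [_ H] [Uy _] gn.
  by apply/eqP/negP => /negP g0; apply: (H g) => //; rewrite mem_cube.
- move=> y; suff [l Al] : exists l, A l y by exists (pickle l); rewrite pickleK.
  have /choice[p Hp] : forall g : Gam, exists p, g != 0 -> half p y /\ ~ half p (act g y).
    move=> g; have [->|g0] := eqVneq g 0; first by exists (0%N, true).
    have [i [Vi nVi]] := sV _ _ (free g y g0).
    by exists (i, false) => _; rewrite /half /=; split => // /(_ Vi).
  exists [seq p g | g <- cube d n & g != 0]; split.
    by move=> _ /mapP[g + ->]; rewrite mem_filter => /andP[/Hp[]].
  move=> g gn g0 H; have [_] := Hp g g0; apply; apply: H.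
  by apply: map_f; rewrite mem_filter g0.
Qed.

(** Carving around the members of a countable cover, one after the other,
    exhausts the space. *)
Section Iterate.
Variable A : nat -> set Y.
Hypothesis mA : forall i, measurable (A i).
Hypothesis sA : forall i, spread (2 * Rm + w) (A i).
Hypothesis cA : forall y, exists i, A i y.

Fixpoint used (i : nat) : set Y :=
  if i is j.+1 then grow (used j) (A j) else set0.

Lemma measurable_used i : measurable (used i).
Proof. by elim: i => [|i IH]; [exact: measurable0|exact: measurable_grow]. Qed.

Lemma used_mono i j : (i <= j)%N -> used i `<=` used j.
Proof.
elim: j => [|j IH]; first by rewrite leqn0 => /eqP ->.
rewrite leq_eqVlt => /predU1P[-> //|/IH ij] y /ij uy; by left.
Qed.

Lemma core_used i : core (used i) (A i) `<=` used i.+1 `\` used i.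
Proof.
move=> y [g [nuy Ag nPg hg]]; split => //; right; exists g; split => //.
by rewrite (leq_trans hg)// leq_addr.
Qed.

(** [y] belongs to the cell with center [act g y]: it is [k]-close to a point
    claimed by this center, at any round. *)
Definition cellrel (y : Y) (g : Gam) := exists i h,
  (supn h <= k)%N /\ coreat (used i) (A i) (g - h) (act h y).

(** A point that is [k]-close to two cores of the same round has two centers that
    are too close to each other to be distinct; for different rounds, the collar
    of the earlier core keeps the later one at distance more than [2 k]. *)
Lemma cellrel_fun y g g' : cellrel y g -> cellrel y g' -> g = g'.
Proof.
have E a h : act (a - h) (act h y) = act a y by rewrite -actD subrK.
have lt i h a i' h' a' : (i < i')%N -> (supn h <= k)%N -> (supn h' <= k)%N ->
    coreat (used i) (A i) (a - h) (act h y) ->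
    coreat (used i') (A i') (a' - h') (act h' y) -> False.
  move=> ii' hk hk' [_ + + +] [nu' _ _ _]; rewrite !E => Aa na ra.
  apply: nu'; apply: (used_mono ii'); right; exists (a - h'); rewrite E; split => //.
  rewrite (_ : a - h' = (a - h) + (h - h')); last by rewrite addrA subrK.
  rewrite (leq_trans (supnD _ _))// leq_add// (leq_trans (supnD _ _))// supnN.
  by rewrite /w mul2n -addnn leq_add.
move=> [i [h [hk ch]]] [i' [h' [hk' ch']]].
case: (ltngtP i i') => ii'; first by have := lt _ _ _ _ _ _ ii' hk hk' ch ch'.
  by have := lt _ _ _ _ _ _ ii' hk' hk ch' ch.
rewrite -{}ii' in ch'; move: ch ch' => [_ + + +] [_ + + +]; rewrite !E => Ag ng rg Ag' ng' rg'.
apply/esym/eqP; rewrite -subr_eq0; apply/eqP; apply: (sA (i := i) Ag).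
  by rewrite -actD subrK.
rewrite (_ : g' - g = (g' - h') + (h' - h) - (g - h)); last first.
  by rewrite addrA subrK opprB addrA subrK.
have [r1 _] := radP ng; have [r2 _] := radP ng'.
have := supnD (g' - h' + (h' - h)) (- (g - h)); have := supnD (g' - h') (h' - h).
have := supnD h' (- h); rewrite !supnN /w; move: hk hk' rg rg' r1 r2; rewrite /w.
move: (supn _) (supn _) (supn _) (supn _) (supn _) (supn _) (supn _) => *; lia.
Qed.

(** The displacement from a point to the center of its cell.  Two points are in
    the same cell if and only if their displacements lead to the same center, so
    this one function encodes the whole decomposition. *)
Definition base (y : Y) : option Gam :=
  if pselect (exists g, cellrel y g) is left e then Some (projT1 (cid e)) else None.

Lemma baseP y g : base y = Some g <-> cellrel y g.
Proof.
rewrite /base; case: pselect => [e|ne]; last by split => // c; case: ne; exists g.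
case: cid => h /= ch; split; first by case=> <-.
by move=> cg; rewrite (cellrel_fun ch cg).
Qed.

Lemma measurable_cellrel g : measurable [set y | cellrel y g].
Proof.
apply: (measurable_exists (P := fun i => [set y | exists h,
  (supn h <= k)%N /\ coreat (used i) (A i) (g - h) (act h y)])) => i.
apply: (measurable_exists (P := fun h => [set y |
  (supn h <= k)%N /\ coreat (used i) (A i) (g - h) (act h y)])) => h.
have [hk|nhk] := leqP (supn h) k.
  rewrite (_ : mkset _ = act h @^-1` coreat (used i) (A i) (g - h)).
    by apply/mact/measurable_coreat => //; exact: measurable_used.
  by apply/seteqP; split => y /= => [[]|].
by rewrite (_ : mkset _ = set0)//; apply/seteqP; split => y //= -[].
Qed.

Lemma dmeasurable_base : dmeasurable base.
Proof.
apply: dmeasurable_singletons => -[g|].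
  rewrite (_ : mkset _ = [set y | cellrel y g]); first exact: measurable_cellrel.
  by apply/seteqP; split => y /= /baseP.
rewrite (_ : mkset _ = ~` [set y | exists g, cellrel y g]).
  by apply/measurableC/measurable_exists => g; exact: measurable_cellrel.
apply/seteqP; split => y /=; first by move=> bN [g /baseP]; rewrite bN.
by move=> H; case E : (base y) => [g|//]; case: H; exists g; apply/baseP.
Qed.

Lemma base_bound y g : base y = Some g -> (supn g <= Rm + k)%N.
Proof.
move=> /baseP[i [h [hk [_ _ ng rg]]]]; rewrite -(subrK h g).
rewrite (leq_trans (supnD _ _))// leq_add// (leq_trans rg)//.
by rewrite (leq_trans _ (radP ng).1)// leq_addr.
Qed.

(** The displacements [g - h] all lead to one center: the box of radius [r]
    around [y] lies in a single cell. *)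
Definition deep (b : Y -> option Gam) (r : nat) (y : Y) :=
  exists g, forall h, (supn h <= r)%N -> b (act h y) = Some (g - h).

Lemma core_deep i y : core (used i) (A i) y -> deep base k y.
Proof.
move=> [g cg]; exists g => h hk; apply/baseP; exists i, (- h); rewrite supnN actNK.
by rewrite opprK subrK.
Qed.

(** A point outside all cores lies in a gap, namely that of the round in which
    it is removed; summing [gap_le_core] over the rounds bounds the mass of the
    gaps by that of the disjoint cores. *)
Lemma not_deep_mass (R : realType) (mu : probability Y R) (N : set Y) :
  invariant mu -> measurable N -> N `<=` ~` [set y | deep base k y] ->
  (q%:R%:E * mu N <= 1)%E.
Proof.
move=> inv mN Nd.
pose C i := core (used i) (A i); pose G i := gap (used i) (A i).
have mC i : measurable (C i) by apply: measurable_core => //; exact: measurable_used.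
have mG i : measurable (G i) by apply: measurable_gap => //; exact: measurable_used.
have NG : N `<=` \bigcup_i G i.
  move=> y /Nd nd; have [i0 Ai] := cA y.
  have ux : exists i, `[< used i y >].
    exists i0.+1; apply/asboolP; have [u|nu] := pselect (used i0 y); first by left.
    by right; exists 0; rewrite act0; split => //; rewrite supn0.
  case: (ex_minnP ux) => -[|i] /asboolP // ui imin.
  have nui : ~ used i y by move=> u; have := imin i (asboolT u); rewrite ltnn.
  by exists i => //; split => // c; apply: nd; exact: core_deep c.
apply: (@le_trans _ _ (q%:R%:E * \sum_(i <oo) mu (G i))%E).
  by apply: lee_pmul => //; exact: measure_sigma_subadditive NG.
rewrite -nneseriesZl//.
apply: (@le_trans _ _ (\sum_(i <oo) mu (C i))%E).
  apply: lee_nneseries => i _; first by rewrite mule_ge0.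
  apply: gap_le_core => //; first exact: measurable_used.
  by move=> x g Ax Ag gn; apply: (sA Ax Ag); rewrite (leq_trans gn)// leq_addr.
have mUC : measurable (\bigcup_i C i) by exact: bigcup_measurable.
rewrite -measure_semi_bigcup//; first exact: probability_le1.
move=> i j _ _ [y [/core_used[ui nui] /core_used[uj nuj]]].
case: (ltngtP i j) => // ij; first by case: nuj; exact: used_mono ij _ _.
by case: nui; exact: used_mono ij _ _.
Qed.

End Iterate.
End Carving.

(** The order of the quantifiers matters: the decomposition and the bound [D]
    serve all invariant probabilities, so the next generation of cells can be
    chosen from [D] without knowing the probability. *)
Lemma exists_cells (R : realType) disp (Y : measurableType disp) (d : nat)
    (act : {ffun 'I_d -> int} -> Y -> Y) (V : nat -> set Y) (k q : nat) :
  (forall y, act 0 y = y) -> (forall a b y, act (a + b) y = act a (act b y)) ->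
  (forall g (A : set Y), measurable A -> measurable (act g @^-1` A)) ->
  (forall i, measurable (V i)) ->
  (forall y z, y <> z -> exists i, V i y /\ ~ V i z) ->
  (forall g y, g != 0 -> act g y <> y) -> (0 < q)%N ->
  exists (b : Y -> option {ffun 'I_d -> int}) (D : nat),
    [/\ dmeasurable b, forall y g, b y = Some g -> (supn g <= D)%N &
        forall (mu : probability Y R) (N : set Y), invariant act mu ->
          measurable N -> N `<=` ~` [set y | deep act b k y] ->
          (q%:R%:E * mu N <= 1)%E].
Proof.
move=> act0 actD mact mV sV free q0.
have [m Hm] := slow_growth_step d (2 * k) q0.
have [A [mA sA cA]] := spread_cover mact (2 * (m * (2 * k)) + 2 * k)%N mV sV free.
exists (base act k q m A), (m * (2 * k) + k)%N; split.
- exact: dmeasurable_base.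
- by move=> y g; exact: base_bound.
- by move=> mu N inv mN; exact: not_deep_mass.
Qed.

(** * Extending colourings from cells to larger cells *)

Section Colouring.
Context disp (Y : measurableType disp) (d : nat).
Local Notation Gam := {ffun 'I_d -> int}.
Variable act : Gam -> Y -> Y.
Hypothesis act0 : forall y, act 0 y = y.
Hypothesis actD : forall a b y, act (a + b) y = act a (act b y).
Hypothesis mact : forall g (A : set Y), measurable A -> measurable (act g @^-1` A).
Local Notation deepin := (deep act).

(** [a] is an edge of the target, used for checkerboards; the walk of parity [c]
    starts as the checkerboard shifted by [c] and is the unshifted one from time
    [M - 1] on. *)
Variables (W : finType) (F : rel W).
Hypothesis symF : symmetric F.
Variables (a : bool -> W) (walk : bool -> nat -> W) (M : nat).
Hypothesis M0 : (0 < M)%N.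
Hypothesis aF : forall c, F (a c) (a (~~ c)).
Hypothesis walk0 : forall c, walk c 0 = a c.
Hypothesis walk1 : forall c, walk c 1 = a (~~ c).
Hypothesis walkF : forall c t, F (walk c t) (walk c t.+1).
Hypothesis walkE : forall c t, (M <= t.+1)%N -> walk c t = a (odd t).

Lemma deep_shift (b : Y -> option Gam) r s g y :
  (supn g <= s)%N -> deepin b (r + s) y -> deepin b r (act g y).
Proof.
move=> gs [c H]; exists (c - g) => h hr; rewrite -actD H.
  by rewrite opprD addrCA addrC.
by rewrite (leq_trans (supnD _ _))// leq_add.
Qed.

Lemma deep_le (b : Y -> option Gam) r s y : (r <= s)%N -> deepin b s y -> deepin b r y.
Proof. by move=> rs [c H]; exists c => h hr; apply: H; exact: leq_trans rs. Qed.

Lemma deep_base (b : Y -> option Gam) r y : deepin b r y -> exists c, b y = Some c.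
Proof.
move=> [c H]; exists c; have := H 0; rewrite act0 subr0; apply.
by rewrite supn0.
Qed.

Lemma deep_step (b : Y -> option Gam) r y c g : (0 < r)%N -> (supn g <= 1)%N ->
  deepin b r y -> b y = Some c -> b (act g y) = Some (c - g).
Proof.
move=> r0 g1 [c' H]; have := H 0; rewrite act0 subr0 supn0 => -> // -[<-].
by apply: H; exact: leq_trans r0.
Qed.

Lemma measurable_deep (b : Y -> option Gam) r : dmeasurable b ->
  measurable [set y | deepin b r y].
Proof.
move=> mb.
apply: (@measurable_exists _ _ Gam) => g.
apply: (@measurable_forall _ _ Gam (fun h => [set y | (supn h <= r)%N ->
  b (act h y) = Some (g - h)])) => h.
apply: measurable_imply.
exact: (dmeasurable_act mact h mb [set Some (g - h)]).
Qed.

(** The distance to the boundary of the cell, truncated at [M]: the largest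
    [j <= M] such that the point is [j]-deep. *)
Definition depth (b : Y -> option Gam) (y : Y) : nat :=
  find (fun j => ~~ `[< deepin b j.+1 y >]) (iota 0 M).

Lemma depth_gt b y j : (j < depth b y)%N <-> (j < M)%N /\ deepin b j.+1 y.
Proof.
split=> [jd|[jM dj]].
  have jM : (j < M)%N.
    by rewrite (leq_trans jd)// (leq_trans (find_size _ _))// size_iota.
  split => //; have := before_find 0%N jd; rewrite nth_iota// add0n.
  by move=> /negbFE/asboolP.
rewrite ltnNge; apply/negP => fj.
have fM : (depth b y < M)%N by exact: leq_ltn_trans jM.
have hs : has (fun j => ~~ `[< deepin b j.+1 y >]) (iota 0 M).
  by rewrite has_find size_iota.
have := nth_find 0%N hs; rewrite nth_iota// add0n => /asboolPn; apply.
exact: deep_le dj.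
Qed.

Lemma depth_le b y : (depth b y <= M)%N.
Proof. by rewrite (leq_trans (find_size _ _))// size_iota. Qed.

Lemma depth_lt b y : (depth b y < M)%N <-> ~ deepin b M y.
Proof.
split=> [lt dM|nd].
  have : (M.-1 < depth b y)%N by apply/depth_gt; rewrite prednK.
  by move: lt M0; lia.
rewrite ltn_neqAle depth_le andbT; apply/eqP => E; apply: nd.
have : (M.-1 < depth b y)%N by rewrite E; lia.
by move/depth_gt => []; rewrite prednK.
Qed.

Lemma depth_step b y g : (supn g <= 1)%N -> (depth b y <= (depth b (act g y)).+1)%N.
Proof.
move=> g1; case E : (depth b y) => [//|j]; rewrite ltnS.
case: j E => [//|j] E.
have /depth_gt[jM dj] : (j.+1 < depth b y)%N by rewrite E.
apply/depth_gt; split; first exact: ltnW.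
by apply: deep_shift g1 _; rewrite addn1.
Qed.

Lemma dmeasurable_depth b : dmeasurable b -> dmeasurable (depth b).
Proof.
move=> mb; rewrite (_ : depth b = (fun l => find negb l) \o
    (fun y => [seq `[< deepin b j.+1 y >] | j <- iota 0 M])).
  apply/dmeasurable_comp/dmeasurable_map => j.
  exact/dmeasurable_asbool/measurable_deep.
by apply/funext => y /=; rewrite find_map.
Qed.

(** The depth rounded up to the parity of the displacement [c].  The depth itself
    may stay constant along an edge; its rounding changes by exactly one along
    every edge inside a cell, so a walk can be composed with it. *)
Definition level (n : nat) (c : Gam) : nat := (n + (odd n (+) par c))%N.

Lemma odd_level n c : odd (level n c) = par c.
Proof. by rewrite oddD oddb addKb. Qed.

(** From a colouring [f] of the cells of [b] to a colouring of the cells of [b'].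
    Cells of [b] whose center is deep in a cell of [b'], and which are thus
    inside it together with an [M]-neighbourhood, keep their colouring at depth
    [M] and interpolate near the boundary between their own checkerboard and
    that of the large cell.  Everything else in a cell of [b'] gets the
    checkerboard of that cell.  Testing the center makes the decision the same for all
    points of a cell. *)
Definition extend (b b' : Y -> option Gam) (D : nat) (f : Y -> W) (y : Y) : W :=
  if b' y is Some g' then
    if b y is Some g then
      if `[< deepin b' (M + D) (act g y) >] then
        if (depth b y < M)%N then walk (par g (+) par g') (level (depth b y) g)
        else f y
      else a (par g')
    else a (par g')
  else a false.

(** The second clause, a checkerboard at depth less than [M], is what allows the
    next extension to modify the colouring near the boundary. *)
Definition hom_on_cells (b : Y -> option Gam) (f : Y -> W) :=
  (forall y i c, b y = Some c -> b (act (gen i) y) = Some (c - gen i) ->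
     F (f y) (f (act (gen i) y))) /\
  (forall y c, b y = Some c -> ~ deepin b M y -> f y = a (par c)).

Lemma par_subgen i (c : Gam) : par (c - gen i) = ~~ par c.
Proof. by rewrite parD parN par_gen addbT. Qed.

Lemma hom_on_cells0 (b : Y -> option Gam) :
  hom_on_cells b (fun y => if b y is Some c then a (par c) else a false).
Proof.
split=> [y i c -> ->|y c -> //].
by rewrite par_subgen.
Qed.

Section Extend.
Variables (b b' : Y -> option Gam) (D : nat) (f : Y -> W).
Hypothesis bD : forall y g, b y = Some g -> (supn g <= D)%N.
Hypothesis hf : hom_on_cells b f.
Local Notation f' := (extend b b' D f).

(** On the boundary of a small cell the interpolation starts as the checkerboard
    of the large one. *)
Lemma extend_boundary y g' : b' y = Some g' -> ~ deepin b 1 y -> f' y = a (par g').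
Proof.
rewrite /extend => -> nd; case: (b y) => [c|//]; case: asboolP => // _.
have -> : depth b y = 0%N.
  by case E : (depth b y) => [//|j]; by case: nd; have /depth_gt[] : (0 < depth b y)%N by rewrite E.
rewrite M0 /level add0n addFb; case: (par c) => /=.
  by rewrite walk1 negbK.
by rewrite walk0.
Qed.

(** Inside one small cell.  In the collar, the levels of the two ends differ by
    one and the walk has an edge there; further inside, [f] is a homomorphism;
    at depth [M - 1] the walk has already reached the checkerboard, which is
    [f]. *)
Lemma extend_edge y i c g' : b y = Some c -> b (act (gen i) y) = Some (c - gen i) ->
  b' y = Some g' -> b' (act (gen i) y) = Some (g' - gen i) ->
  F (f' y) (f' (act (gen i) y)).
Proof.
move=> by_ by1 b'y b'y1; rewrite /extend by_ by1 b'y b'y1.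
rewrite -actD subrK !par_subgen.
case: asboolP => _; last exact: aF.
have -> : ~~ par c (+) ~~ par g' = par c (+) par g' by case: (par c); case: (par g').
set z := par c (+) par g'; set y1 := act (gen i) y.
have k1 := depth_step b y (supn_gen i).
have k2 : (depth b y1 <= (depth b y).+1)%N.
  have := @depth_step b y1 (- gen i); rewrite supnN => /(_ (supn_gen i)).
  by rewrite -actD addNr act0.
rewrite -/y1 in k1.
have l1 : odd (level (depth b y) c) = par c := odd_level _ _.
have l2 : odd (level (depth b y1) (c - gen i)) = ~~ par c.
  by rewrite odd_level par_subgen.
have fF := hf.1 y i c by_ by1.
have E1 : (depth b y < M)%N -> f y = a (par c) by move=> /depth_lt; exact: hf.2.
have E2 : (depth b y1 < M)%N -> f y1 = a (~~ par c).
  by move=> /depth_lt/(hf.2 _ _ by1); rewrite par_subgen.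
have lev n (e : Gam) : (n <= level n e <= n.+1)%N by rewrite /level; case: (_ (+) _); lia.
have := lev (depth b y) c; have := lev (depth b y1) (c - gen i).
move: k1 k2 l1 l2 E1 E2; rewrite -/y1 in fF *.
set n := depth b y; set n1 := depth b y1.
set l := level n c; set l1 := level n1 _ => k1 k2 o1 o2 E1 E2 /andP[h1 h2] /andP[h3 h4].
have [nM|nM] := ltnP n M; have [n1M|n1M] := ltnP n1 M => //.
- have [E|E] : l1 = l.+1 \/ l = l1.+1.
    by case: (par c) o1 o2 => o1 o2; lia.
  + by rewrite E.
  + by rewrite E symF.
- by rewrite walkE ?o1 -?E1//; lia.
- by rewrite walkE ?o2 -?E2//; lia.
Qed.

(** An edge between different small cells, or with an end outside of them, joins
    points that are not [1]-deep, and there the new colouring is the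
    checkerboard of the large cell. *)
Lemma hom_on_cells_extend : hom_on_cells b' f'.
Proof.
split=> [y i g' b'y b'y1|y g' b'y nd]; last first.
  rewrite /extend b'y; case by_ : (b y) => [c|//]; case: asboolP => // dz.
  case: nd; rewrite -(actNK act0 actD c y).
  by apply: (deep_shift (s := D)) dz; rewrite supnN; exact: bD by_.
have [same|nsame] := pselect (exists c, b y = Some c /\ b (act (gen i) y) = Some (c - gen i)).
  by have [c [by_ by1]] := same; exact: extend_edge by_ by1 b'y b'y1.
rewrite (extend_boundary b'y) ?(extend_boundary b'y1) ?par_subgen//.
- move=> d1; apply: nsame; have [c by1] := deep_base d1.
  exists (c + gen i); rewrite addrK; split => //.
  have := @deep_step b 1 _ c (- gen i) isT _ d1 by1.
  by rewrite supnN supn_gen actNK// opprK; apply.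
- move=> d1; apply: nsame; have [c by_] := deep_base d1.
  exists c; split => //; apply: (deep_step _ _ d1 by_) => //; exact: supn_gen.
Qed.

Lemma extend_stable y : deepin b M y -> deepin b' (M + D + D) y -> f' y = f y.
Proof.
move=> dM dMD; have [c by_] := deep_base dM; have [g' b'y] := deep_base dMD.
rewrite /extend by_ b'y; case: asboolP => [_|[]].
  by case: ifP => // /depth_lt.
exact: deep_shift (bD by_) dMD.
Qed.

Lemma dmeasurable_extend : dmeasurable b -> dmeasurable b' -> dmeasurable f ->
  dmeasurable f'.
Proof.
move=> mb mb' mf.
apply: (dmeasurable_select (f := fun o y => if o.2 is Some g' then
    if o.1 is Some g then
      if `[< deepin b' (M + D) (act g y) >] then
        if (depth b y < M)%N then walk (par g (+) par g') (level (depth b y) g)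
        else f y
      else a (par g')
    else a (par g')
  else a false) (dmeasurable_pair mb mb')) => -[[g|] [g'|]] /=; try exact: dmeasurable_cst.
apply: (dmeasurable_comp (fun p : bool * (nat * W) => if p.1 then
    if (p.2.1 < M)%N then walk (par g (+) par g') (level p.2.1 g) else p.2.2
  else a (par g')) (f := fun y => (`[< deepin b' (M + D) (act g y) >], (depth b y, f y)))).
apply: dmeasurable_pair; last by apply: dmeasurable_pair => //; exact: dmeasurable_depth.
apply: (dmeasurable_act mact (f := fun y => `[< deepin b' (M + D) y >])).
exact/dmeasurable_asbool/measurable_deep.
Qed.

End Extend.

(** * The limit colouring *)

Section Limit.
Context (R : realType).
Hypothesis cells : forall k q, (0 < q)%N ->
  exists (b : Y -> option Gam) (D : nat),
    [/\ dmeasurable b, forall y g, b y = Some g -> (supn g <= D)%N &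
        forall (mu : probability Y R) (N : set Y), invariant act mu ->
          measurable N -> N `<=` ~` [set y | deepin b k y] ->
          (q%:R%:E * mu N <= 1)%E].

(** Being [K n.+1]-deep in generation [n + 1] must imply that the whole cell of
    generation [n], of radius [D n], is extended and not repainted: [D n] to reach
    the center, and [M + D n] for the test in [extend]. *)
Lemma exists_cell_sequence : exists (b : nat -> Y -> option Gam) (D K : nat -> nat),
  forall n, [/\ dmeasurable (b n), forall y g, b n y = Some g -> (supn g <= D n)%N,
    (M <= K n)%N, K n.+1 = (M + D n + D n)%N &
    forall (mu : probability Y R), invariant act mu ->
      ((2 ^ n.+1)%:R%:E * mu (~` [set y | deepin (b n) (K n) y]) <= 1)%E].
Proof.
have /choice[c Hc] : forall p : nat * nat, exists bD : (Y -> option Gam) * nat,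
    [/\ dmeasurable bD.1, forall y g, bD.1 y = Some g -> (supn g <= bD.2)%N &
        forall (mu : probability Y R) (N : set Y), invariant act mu ->
          measurable N -> N `<=` ~` [set y | deepin bD.1 p.1 y] ->
          ((2 ^ p.2)%:R%:E * mu N <= 1)%E].
  move=> [k n]; have [b [D [? ? ?]]] := @cells k (2 ^ n) (expn_gt0 2 n).
  by exists (b, D).
pose K := fix K n := if n is j.+1 then
  let D := (c (K j, n)).2 in (M + D + D)%N else M.
exists (fun n => (c (K n, n.+1)).1), (fun n => (c (K n, n.+1)).2), K => n.
have [mb bD Hmu] := Hc (K n, n.+1); split => //.
- by case: n {mb bD Hmu} => //= n; rewrite -addnA leq_addr.
- by move=> mu inv; apply: Hmu => //; exact/measurableC/measurable_deep.
Qed.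

(** The colour of a point is eventually constant unless the point fails to be
    [K n]-deep for infinitely many [n]; the masses of these failures are
    summable. *)
Lemma almost_hom_of_cells : exists (f : Y -> W) (N : set Y),
  [/\ dmeasurable f, measurable N,
      forall mu : probability Y R, invariant act mu -> mu N = 0%E &
      forall y i, ~ N y -> ~ N (act (gen i) y) -> F (f y) (f (act (gen i) y))].
Proof.
have [b [D [K H]]] := exists_cell_sequence.
pose f := fix f n := if n is j.+1 then extend (b j) (b n) (D j) (f j)
  else fun y => if b 0%N y is Some c then a (par c) else a false.
have mb n : dmeasurable (b n) by case: (H n).
have mf n : dmeasurable (f n).
  elim: n => [|n IH] /=; last exact: dmeasurable_extend.
  exact: (dmeasurable_comp (fun o => if o is Some c then a (par c) else a false)).
have hf n : hom_on_cells (b n) (f n).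
  elim: n => [|n IH]; first exact: hom_on_cells0.
  by apply: hom_on_cells_extend => //; case: (H n).
pose bad n := ~` [set y | deepin (b n) (K n) y].
have mbad n : measurable (bad n) by exact/measurableC/measurable_deep.
pose ev w := [set y | exists n, forall m, (n <= m)%N -> f m y = w].
have mev w : measurable (ev w).
  apply: measurable_exists => n.
  apply: (measurable_forall (P := fun m => [set y | (n <= m)%N -> f m y = w])) => m.
  by apply: measurable_imply; exact: (mf m [set w]).
(* the eventual colour, and a fixed default one where there is none *)
pose g y := nth (a false) (enum W) (find (fun w => `[< ev w y >]) (enum W)).
have gE w y : ev w y -> g y = w.
  move=> [n Hn]; have hs : has (fun w => `[< ev w y >]) (enum W).
    by apply/hasP; exists w; rewrite ?mem_enum//; apply/asboolP; exists n.
  have /asboolP[n' Hn'] := nth_find (a false) hs.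
  by rewrite /g -(Hn' (maxn n n')) ?leq_maxr// (Hn (maxn n n'))// leq_maxl.
have stab y : ~ lim_sup_set bad y -> exists n, forall m, (n <= m)%N ->
    deepin (b m) (K m) y /\ f m y = g y.
  move=> /existsNP[n /not_implyP[_ Hn]].
  have dn m : (n <= m)%N -> deepin (b m) (K m) y.
    by move=> nm; apply: contrapT => nd; apply: Hn; exists m.
  have cst m : (n <= m)%N -> f m y = f n y.
    elim: m => [|m IH]; first by rewrite leqn0 => /eqP ->.
    rewrite leq_eqVlt => /predU1P[-> //|nm]; rewrite -IH//.
    have [_ bD MK KS _] := H m; apply: extend_stable => //.
      by apply: deep_le MK _; exact: dn.
    by rewrite -KS; apply: dn; rewrite ltnW.
  exists n => m nm; split; first exact: dn.
  by rewrite (gE (f n y)) ?cst//; exists n.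
exists g, (lim_sup_set bad); split.
- rewrite (_ : g = (fun l => nth (a false) (enum W) (find id l)) \o
    (fun y => [seq `[< ev w y >] | w <- enum W])).
    by apply/dmeasurable_comp/dmeasurable_map => w; exact: dmeasurable_asbool.
  by apply/funext => y /=; rewrite find_map.
- apply: bigcap_measurable => // n _.
  by apply: bigcup_measurable => m _.
- move=> mu inv; apply: lim_sup_set_cvg0 => //.
  apply: (@le_lt_trans _ _ (1%:E)); last exact: ltry.
  apply: le_trans (epsilon_trick0 xpredT ler01).
  apply: lee_nneseries => // n _.
  suff : (mu (bad n) <= (1 / (2 ^ n.+1)%:R)%:E)%E by [].
  have [_ _ _ _ /(_ mu inv)] := H n; rewrite -/(bad n).
  rewrite -(@fineK _ (mu (bad n))) ?fin_num_measure// -EFinM !lee_fin.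
  by rewrite mulrC ler_pdivlMr ?ltr0n ?expn_gt0.
- move=> y i /stab[n Hn] /stab[n1 Hn1].
  pose m := maxn n n1.
  have [dy <-] := Hn m (leq_maxl _ _); have [_ <-] := Hn1 m (leq_maxr _ _).
  have [_ _ MK _ _] := H m.
  have [c by_] := deep_base dy.
  apply: ((hf m).1 _ _ _ by_); apply: (deep_step _ _ dy by_); last exact: supn_gen.
  exact: leq_trans MK.
Qed.

End Limit.
End Colouring.

(** * Walks in a connected non-bipartite graph *)

Section Walks.
Variables (W : finType) (F : rel W).
Hypothesis symF : symmetric F.

Definition walks (n : nat) (x y : W) := exists u : nat -> W,
  [/\ u 0%N = x, u n = y & forall t, (t < n)%N -> F (u t) (u t.+1)].

Lemma walks0 x : walks 0 x x. Proof. by exists (fun=> x). Qed.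

Lemma walks1 n x y z : walks n x y -> F y z -> walks n.+1 x z.
Proof.
move=> [u [u0 un uF]] yz; exists (fun t => if (t <= n)%N then u t else z).
rewrite leq0n ltnn; split => // t; rewrite ltnS => tn; rewrite tn.
by move: tn; rewrite leq_eqVlt => /predU1P[->|/[dup] tn ->]; [rewrite ltnn un|exact: uF].
Qed.

Lemma walks_cat n m x y z : walks n x y -> walks m y z -> walks (n + m) x z.
Proof.
elim: m z => [|m IH] z nxy [u [u0 um uF]].
  by rewrite addn0 -um u0.
rewrite addnS -um; apply: walks1 (uF m (ltnSn m)); apply: IH => //.
by exists u; split => // t tm; apply: uF; rewrite ltnW.
Qed.

Lemma walks_rev n x y : walks n x y -> walks n y x.
Proof.
move=> [u [u0 un uF]]; exists (fun t => u (n - t)%N).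
rewrite subn0 subnn; split => // t tn.
by have := uF (n - t.+1)%N; rewrite symF subnSK// => ->//; lia.
Qed.

Lemma connect_walks x y : connect F x y -> exists n, walks n x y.
Proof.
move=> /connectP[p + ->]; elim/last_ind: p => [|p z IH] /=; first by exists 0%N; exact: walks0.
rewrite rcons_path last_rcons => /andP[/IH[n wn] Fz].
by exists n.+1; exact: walks1 Fz.
Qed.

Hypothesis conF : connected_graph F.
Hypothesis nbipF : ~ bipartite F.

(** Otherwise all walks from [x] to a given vertex have the same parity, and this
    parity is a proper 2-colouring. *)
Lemma odd_closed_walk x : exists2 n, odd n & walks n x x.
Proof.
apply: contrapT => H; apply: nbipF.
have even_odd y n m : walks n x y -> walks m x y -> odd n = odd m.
  move=> wn wm; apply/eqP/negP => /negP nm; apply: H; exists (n + m)%N.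
    by rewrite oddD; case: (odd n) (odd m) nm => [] [].
  exact: walks_cat (walks_rev wm).
exists (fun y => `[< exists2 n, odd n & walks n x y >]) => y z yz.
have [n wn] := connect_walks (conF x y); have wz := walks1 wn yz.
have -> : `[< exists2 n, odd n & walks n x y >] = odd n.
  apply/asboolP/idP => [[m om /even_odd/(_ wn) <-]//|on]; by exists n.
have -> : `[< exists2 n, odd n & walks n x z >] = odd n.+1.
  apply/asboolP/idP => [[m om /even_odd/(_ wz) <-]//|on]; by exists n.+1.
by rewrite /= ; case: odd.
Qed.

(** The walk for [true] makes one step from [a true] to [a false], runs through an
    odd closed walk and then oscillates: the odd length exchanges the
    parities. *)
Lemma parity_walks : exists (a : bool -> W) (walk : bool -> nat -> W) (M : nat),
  [/\ (0 < M)%N, forall c, F (a c) (a (~~ c)),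
      (forall c, walk c 0 = a c) /\ (forall c, walk c 1 = a (~~ c)),
      forall c t, F (walk c t) (walk c t.+1) &
      forall c t, (M <= t.+1)%N -> walk c t = a (odd t)].
Proof.
have [x [y xy]] : exists x y, F x y.
  apply: contrapT => H; apply: nbipF; exists (fun=> true) => x y xy.
  by case: H; exists x, y.
have [l ol [u [u0 ul uF]]] := odd_closed_walk x.
pose a c := if c then y else x.
have aF c : F (a c) (a (~~ c)) by case: c => //=; rewrite symF.
pose walk c t := if c then
    (if t is s.+1 then if (s <= l)%N then u s else a (odd t) else a true)
  else a (odd t).
exists a, walk, l.+2; split => //.
- by split=> -[] //=; rewrite u0.
- case=> [|] t; last by rewrite /walk /=; exact: aF.
  case: t => [|s]; first by rewrite /walk leq0n u0; exact: (aF true).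
  rewrite /walk; case: (ltngtP s l) => sl.
  + by rewrite uF.
  + exact: aF.
  + by rewrite sl ul /= ol /=.
- case=> [|] t //; rewrite !ltnS /walk; case: t => // s ls.
  case: leqP => // sl; have -> : s = l by apply/eqP; rewrite eqn_leq sl /=; move: ls; lia.
  by rewrite ul /= ol.
Qed.

End Walks.

(** * Almost homomorphisms and chromatic numbers *)

Section Main.
Context (R : realType) (disp : measure_display) (Y : measurableType disp).
Hypothesis hY : standard_borel R Y.
Context (d : nat) (T : 'I_d -> Y -> Y).
Hypothesis hT : forall i : 'I_d, borel_bijection (T i).
Hypothesis hcomm : forall (i j : 'I_d) (y : Y), T i (T j y) = T j (T i y).
Local Notation null := (graph_null R (action_graph T)).

Lemma action_graphP v w : action_graph T v w <-> exists j, w = T j v \/ v = T j w.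
Proof.
have TK j := bij_pinvK (hT j).2; have SK j := bij_pinvVK (hT j).2.
split=> -[j]; first by case=> ->; exists j; [left|right; rewrite /= SK].
by case=> ->; exists j; [left|right; rewrite /= TK].
Qed.

Lemma almost_hom (W : finType) (F : rel W) : generate_free_Zd_action T ->
  symmetric F -> connected_graph F -> ~ bipartite F ->
  exists f : Y -> W, borel_almost_hom R (action_graph T) discrete_measurable F f.
Proof.
move=> hfree symF conF nbF.
have [a [walk [M [M0 aF [w0 w1] wF wE]]]] := parity_walks symF conF nbF.
have act0T := @act0 _ Y d T.
have actDT := actD hT hcomm.
have mactT := measurable_act hY hT.
have [V [mV sV]] := separating_family hY.
have [f [N [mf mN N0 fF]]] := almost_hom_of_cells act0T actDT mactT symF M0 aF
  w0 w1 wF wE (fun k q q0 => exists_cells R k act0T actDT mactT mV sV hfree q0).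
exists f; split; first by move=> A _; exact: mf.
exists N.
  split => // mu inv; apply: N0 => g A mA.
  exact: invariant_act.
move=> v w nv nw /action_graphP[j [e|e]].
  by rewrite e -(act_gen T) fF// act_gen -?e.
by rewrite symF e -(act_gen T) fF// act_gen -?e.
Qed.

Lemma null_sub (N N' : set Y) : measurable N' -> N' `<=` N -> null N -> null N'.
Proof.
move=> mN' NN' [mN N0]; split => // mu inv; apply/eqP; rewrite -measure_le0.
by rewrite -(N0 mu inv) le_measure ?inE.
Qed.

(** [~` G] is the union of the countably many translates of [N], each of which is
    null because the action preserves invariant probabilities. *)
Lemma null_saturation (N : set Y) : null N -> exists G : set Y,
  [/\ measurable G, null (~` G), G `<=` ~` N & forall i y, G (T i y) <-> G y].
Proof.
move=> [mN N0]; pose G := [set y | forall g, ~ N (Zd_act T g y)].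
have mG : measurable G.
  by apply: measurable_forall => g; exact: (measurable_act hY hT g (measurableC mN)).
exists G; split => //.
- split; first exact: measurableC.
  move=> mu inv; apply/eqP; rewrite -measure_le0.
  pose E n := if unpickle n is Some g then Zd_act T g @^-1` N else set0.
  have mE n : measurable (E n).
    by rewrite /E; case: unpickle => [g|]; [exact: (measurable_act hY hT g mN)|exact: measurable0].
  have E0 n : mu (E n) = 0%E.
    rewrite /E; case: unpickle => [g|]; last exact: measure0.
    by rewrite (invariant_act hY hT)// N0.
  have GE : ~` G `<=` \bigcup_n E n.
    move=> y /existsNP[g /contrapT Ng]; exists (pickle g) => //.
    by rewrite /E pickleK.
  have := measure_sigma_subadditive mu mE (measurableC mG) GE.
  by rewrite eseries0; [|move=> n _ _; exact: E0].
- by move=> y Gy Ny; apply: (Gy 0); rewrite act0.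
- move=> i y; split=> Gy g.
    have := Gy (g - gen i); rewrite -(act_gen T) -(actD hT hcomm).
    by rewrite subrK.
  by rewrite -(act_gen T) -(actD hT hcomm); exact: Gy.
Qed.

Hypothesis hd : (0 < d)%N.
Hypothesis nnull : ~ null [set: Y].

(** With at most one colour, every point whose orbit avoids the exceptional set
    would violate properness; so the saturation of that set would be the whole
    space. *)
Lemma colorable_ge2 m : almost_borel_colorable R (action_graph T) m -> (2 <= m)%N.
Proof.
move=> [c [_ [N nN Nc]]]; rewrite ltnNge; apply/negP => m1.
have [G [mG nG GN GT]] := null_saturation nN.
apply: nnull; suff <- : ~` G = setT by [].
apply/seteqP; split => // y _ Gy.
pose i := Ordinal hd.
apply: (Nc y (T i y)); [exact: GN|by apply: GN; exact/GT|by apply/action_graphP; exists i; left|].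
by apply: val_inj; have := ltn_ord (c y); have := ltn_ord (c (T i y)) => /=; lia.
Qed.

Lemma colorable3 : generate_free_Zd_action T ->
  almost_borel_colorable R (action_graph T) 3.
Proof.
move=> hfree; have [|||f [mf [N nN Nf]]] := @almost_hom 'I_3 (fun x y => x != y) hfree.
- by move=> x y; rewrite eq_sym.
- move=> x y; have [->|xy] := eqVneq x y; first exact: connect0.
  exact: connect1.
- move=> [s Hs].
  have s01 : s ord0 != s (inord 1) by apply: Hs; rewrite -val_eqE /= inordK.
  have s02 : s ord0 != s (inord 2) by apply: Hs; rewrite -val_eqE /= inordK.
  have : s (inord 1) != s (inord 2) by apply: Hs; rewrite -val_eqE /= !inordK.
  by move: s01 s02; do 3!case: (s _).
exists f; split; first by move=> A; exact: mf.
by exists N => // v w nv nw vw; apply/eqP; exact: Nf.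
Qed.

Lemma colorable2_partition : almost_borel_colorable R (action_graph T) 2 <->
  exists Y0 Y1 : set Y,
    [/\ measurable Y0, measurable Y1, Y0 `&` Y1 = set0, null (~` (Y0 `|` Y1)) &
        forall i : 'I_d, T i @` Y0 = Y1 /\ T i @` Y1 = Y0].
Proof.
split=> [[c [mc [N nN Nc]]]|[Y0 [Y1 [mY0 mY1 Y01 nY YT]]]].
  have [G [mG nG GN GT]] := null_saturation nN.
  pose Z (e : 'I_2) := G `&` c @^-1` [set e].
  have mZ e : measurable (Z e) by exact: measurableI.
  have ZT i e e' : e != e' -> T i @` Z e = Z e'.
    have flip y : G y -> c y <> c (T i y).
      move=> Gy; apply: Nc; [exact: GN|by apply: GN; exact/GT|].
      by apply/action_graphP; exists i; left.
    have two (u v w : 'I_2) : u != v -> w <> u -> w = v.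
      move=> /eqP uv wu; apply: val_inj.
      have uv' : val u <> val v by move/val_inj.
      have wu' : val w <> val u by move/val_inj.
      by move: (ltn_ord u) (ltn_ord v) (ltn_ord w) uv' wu' => /=; lia.
    move=> ee'; apply/seteqP; split => [_ [y [Gy cy] <-]|z [Gz cz]].
      split; first exact/GT.
      apply: (two e) => //; move: (flip y Gy); rewrite cy => h1 h2; exact: h1.
    have [S TS ST] := (hT i).2.
    exists (S z); last exact: ST.
    have GS : G (S z) by apply/(GT i); rewrite ST.
    split => //; apply: (two e') => //; first by rewrite eq_sym.
    by have := flip _ GS; rewrite ST cz.
  exists (Z ord0), (Z ord_max); split => //.
  - apply/seteqP; split => // y [[_ /= e0] [_ /= e1]].
    by have := congr1 val (etrans (esym e0) e1).
  - apply: null_sub nG; first by apply/measurableC/measurableU.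
    move=> y H Gy; apply: H.
    case E : (c y) => [[|[|//]] h]; [left|right]; split => //; apply: val_inj; by rewrite E.
  - by move=> i; split; exact: ZT.
exists (fun y => if `[< Y0 y >] then ord0 else ord_max); split.
  move=> A.
  exact: (dmeasurable_comp (fun b : bool => if b then ord0 else ord_max)
    (dmeasurable_asbool mY0) A).
exists (~` (Y0 `|` Y1)) => // v w /contrapT Yv /contrapT Yw.
have sw j x : Y0 x \/ Y1 x -> `[< Y0 (T j x) >] = ~~ `[< Y0 x >].
  have [E0 E1] := YT j.
  have disj z : Y0 z -> Y1 z -> False by move=> z0 z1; rewrite -[False]/(set0 z) -Y01.
  move=> [x0|x1].
    have T1 : Y1 (T j x) by rewrite -E0; exists x.
    by rewrite (asboolT x0); apply/asboolPn => T0; exact: disj T0 T1.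
  have T0 : Y0 (T j x) by rewrite -E1; exists x.
  by rewrite (asboolT T0); apply/esym/asboolPn => x0; exact: disj x0 x1.
move=> /action_graphP[j [e|e]].
  by rewrite e sw//; case: asboolP => _ /(congr1 val).
by rewrite e sw//; case: asboolP => _ /(congr1 val).
Qed.

End Main.

Theorem corollary9p17 (R : realType) (disp : measure_display)
    (Y : measurableType disp) (hY : standard_borel R Y)
    (d : nat) (hd : (0 < d)%N) (T : 'I_d -> Y -> Y)
    (hT : forall i : 'I_d, borel_bijection (T i))
    (hcomm : forall (i j : 'I_d) (y : Y), T i (T j y) = T j (T i y))
    (hfree : generate_free_Zd_action T) :
  (forall (W : finType) (F : rel W),
     symmetric F -> connected_graph F -> ~ bipartite F ->
     exists f : Y -> W,
       borel_almost_hom R (action_graph T) discrete_measurable F f) /\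
  (~ graph_null R (action_graph T) [set: Y] ->
     (almost_borel_chromatic_number_is R (action_graph T) 2 \/
      almost_borel_chromatic_number_is R (action_graph T) 3) /\
     (almost_borel_chromatic_number_is R (action_graph T) 2 <->
      exists Y0 Y1 : set Y,
        [/\ measurable Y0, measurable Y1, Y0 `&` Y1 = set0,
            graph_null R (action_graph T) (~` (Y0 `|` Y1)) &
            forall i : 'I_d, T i @` Y0 = Y1 /\ T i @` Y1 = Y0])).
Proof.
split=> [W F|nnull]; first exact: almost_hom.
have ge2 := colorable_ge2 hY hT hcomm hd nnull.
have two : almost_borel_chromatic_number_is R (action_graph T) 2 <->
    almost_borel_colorable R (action_graph T) 2 by split=> [[]|].
split; last first.
  by rewrite two; exact: colorable2_partition.
have [c2|nc2] := pselect (almost_borel_colorable R (action_graph T) 2).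
  by left; exact/two.
right; split; first exact: colorable3.
move=> m cm; have := ge2 m cm; rewrite leq_eqVlt => /predU1P[e|//].
by case: nc2; rewrite e.
Qed.
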